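(* For $m\in\mathbb Z_{>0}$ and $\nu\in\sigma\cap N_j$ such that $n_1\cdots n_g\langle\nu,\gamma_1\rangle\le m$, we have $$D_m^\nu=\bigl(\pi^a_{m,[\frac m{e_j}]}\bigr)^{-1}\bigl(D^\nu_{j,[\frac m{e_j}]}\bigr),$$ where the integer $j\in\{1,\dots,g\}$ satisfies $$n_j\cdots n_g\langle\nu,\gamma_j\rangle\le m<n_{j+1}\cdots n_g\langle\nu,\gamma_{j+1}\rangle$$ (the right-hand side being $\infty$ for $j=g$), $D^\nu_{j,p}$ denotes the set corresponding to $D^\nu_p$ for the quasi-ordinary surface defined by the $j$-th approximated root, and $\pi^a_{q,p}:\mathbb A^3_q\to\mathbb A^3_p$ is the projection of the jet schemes of the affine ambient space.
   Context: **Setting.** Let $f\in\mathbb C\{x_1,x_2\}[z]$ be an irreducible quasi-ordinary Weierstrass polynomial of degree $n$ in $z$ (its $z$-discriminant is $x_1^{\delta_1}x_2^{\delta_2}$ times a unit), defining the germ $(X,0)\subset(\mathbb C^3,0)$. A root $\zeta=\sum\beta_\lambda x^\lambda\in\mathbb C\{x_1^{1/n},x_2^{1/n}\}$ of $f$ has characteristic exponents $0\neq\lambda_1\le\dots\le\lambda_g$ in $\mathbb Q^2_{\ge0}$ ($g\ge1$, $\le$ coordinatewise): with $M_0=\mathbb Z^2$, $M_j=M_{j-1}+\mathbb Z\lambda_j$, $\lambda_0=0$, $\lambda_{g+1}=\infty$, one has $\beta_{\lambda_i}\ne0$; $\beta_\lambda\neq0$ implies $\lambda\in M_j$ for the unique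 $j$ with $\lambda_j\le\lambda$, $\lambda_{j+1}\not\le\lambda$; and $\lambda_j\notin M_{j-1}$. Put $n_j=[M_j:M_{j-1}]>1$ and $e_j=n_{j+1}\cdots n_g$ ($e_0=n$, $e_g=1$). Standing assumptions: $(\lambda_1^{(1)},\dots,\lambda_g^{(1)})\ge_{lex}(\lambda_1^{(2)},\dots,\lambda_g^{(2)})$; $\zeta$ is normalized, i.e. $\lambda_1$ is not of the form $(a,0)$ with $a<1$; and coordinates are such that $\zeta$ has no terms $\beta_\lambda x^\lambda$ with $\lambda\not\ge\lambda_1$. Put $\gamma_1=\lambda_1$, $\gamma_{j+1}=n_j\gamma_j+\lambda_{j+1}-\lambda_j$. Let $N_0=\mathbb Z^2$, let $N_j=\{\nu\in\mathbb Z^2:\langle\nu,\lambda\rangle\in\mathbb Z\ \forall\lambda\in M_j\}$ be the dual lattice of $M_j$, and $\sigma=\mathbb R^2_{\ge0}$. **Approximated roots.** For $1\le j\le g$, $X^{(j)}=\{f_j=0\}$ is the quasi-ordinary germ parametrized by the truncation $\zeta_j=\sum_{\lambda\not\ge\lambda_{j+1}}\beta_\lambda x^\lambda$, with $f_j\in\mathbb C\{x_1,x_2\}[z]$ its minimal polynomial, of degree $n_1\cdots n_j$ (the $j$-th approximated root); $f_g=f$, $X^{(g)}=X$. **Jets.** $X_m$, $X^{(j)}_m$ are the schemes of $m$-jets and $\mathbb A^3_m$ is the space of $m$-jets of $\mathbb A^3$ (with coordinates $x_1,x_2,z$); $\pi^a_{q,p}$ for $q>p$ is the truncation map (the identity if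 $q=p$). $X$ is a germ: only jets with center in a sufficiently small neighbourhood of $0$ are considered. For $\nu=(\nu_1,\nu_2)$ with $\nu_k\le m$, $D_m^\nu=\{\gamma\in X_m:\mathrm{ord}_t(x_k\circ\gamma)=\nu_k,\ k=1,2\}$ with reduced structure; and $D^\nu_{j,p}=\{\gamma\in X^{(j)}_p:\mathrm{ord}_t(x_k\circ\gamma)=\nu_k,\ k=1,2\}$ with reduced structure. $[\cdot]$ denotes integer part.
   Formalization: The formal theorem adds ν_1, ν_2 ≤ [m/e_j]: if ν_2 > [m/e_j], no [m/e_j]-jet has ord x_2 = ν_2, so the right side is empty while D_m^ν is not, e.g. ζ = x_1^{3/2} + x_1^{3/2}x_2^{5/2}, ν = (2,12), m = 12, j = 1. *)

(* Defs.v *)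
From HB Require Import structures.
From mathcomp Require Import all_boot all_order all_algebra.
From mathcomp Require Import finmap all_classical all_reals all_analysis.
From mathcomp Require Import complex.
Set Implicit Arguments.
Unset Strict Implicit.
Unset Printing Implicit Defensive.
Import Order.TTheory GRing.Theory Num.Theory.
Import numFieldNormedType.Exports.
Local Open Scope classical_set_scope.
Local Open Scope ring_scope.

(** [series2 K] is K[[x1, x2]] and [cseries2 K], below, is K{x1, x2}. They are
    built for arbitrary [K]; the case of interest is [K = R[i]], the complex
    numbers. *)
Record series2 (K : Type) := Series2 { coef2 : nat -> nat -> K }.

HB.instance Definition _ (K : Type) := gen_eqMixin (series2 K).
HB.instance Definition _ (K : Type) := gen_choiceMixin (series2 K).

Section Series2Ring.
Variable K : comNzRingType.
Implicit Types a b c : series2 K.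

Definition zero2 : series2 K := Series2 (fun _ _ => 0).
Definition one2 : series2 K :=
  Series2 (fun i j => ((i == 0%N) && (j == 0%N))%:R).
Definition opp2 a := Series2 (fun i j => - coef2 a i j).
Definition add2 a b := Series2 (fun i j => coef2 a i j + coef2 b i j).
Definition mul2 a b := Series2 (fun i j =>
  \sum_(k < i.+1) \sum_(l < j.+1) coef2 a k l * coef2 b (i - k) (j - l)).

Lemma series2P a b : (forall i j, coef2 a i j = coef2 b i j) -> a = b.
Proof.
case: a b => [a] [b] /= ab; congr Series2.
by apply/funext => i; apply/funext => j.
Qed.

Lemma add2A : associative add2.
Proof. by move=> a b c; apply: series2P => i j /=; rewrite addrA. Qed.
Lemma add2C : commutative add2.
Proof. by move=> a b; apply: series2P => i j /=; rewrite addrC. Qed.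
Lemma add02 : left_id zero2 add2.
Proof. by move=> a; apply: series2P => i j /=; rewrite add0r. Qed.
Lemma addN2 : left_inverse zero2 opp2 add2.
Proof. by move=> a; apply: series2P => i j /=; rewrite addNr. Qed.

Let agree N (p : {poly {poly K}}) a :=
  forall i j, (i < N)%N -> (j < N)%N -> p`_i`_j = coef2 a i j.
Let trunc2 N a := \poly_(i < N) \poly_(j < N) coef2 a i j.

Let agree_trunc N a : agree N (trunc2 N a) a.
Proof. by move=> i j iN jN; rewrite !(coef_poly, iN, jN). Qed.

Let agree_mul N p q a b : agree N p a -> agree N q b ->
  agree N (p * q) (mul2 a b).
Proof.
move=> pa qb i j iN jN; rewrite coefM coef_sum; apply: eq_bigr => k _ /=.
rewrite coefM; apply: eq_bigr => l _.
have kN : (k < N)%N by apply: leq_ltn_trans iN; rewrite -ltnS.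
have lN : (l < N)%N by apply: leq_ltn_trans jN; rewrite -ltnS.
by rewrite pa// qb// (leq_ltn_trans (leq_subr _ _)).
Qed.

Let agree_eq a b :
  (forall N, exists2 p, agree N p a & agree N p b) -> a = b.
Proof.
move=> ab; apply: series2P => i j.
have [p pa pb] := ab (maxn i j).+1.
by rewrite -pa ?pb// ltnS ?leq_maxl ?leq_maxr.
Qed.

Lemma mul2A : associative mul2.
Proof.
move=> a b c; apply: agree_eq => N.
exists (trunc2 N a * (trunc2 N b * trunc2 N c)).
  by do !apply: agree_mul; exact: agree_trunc.
by rewrite mulrA; do !apply: agree_mul; exact: agree_trunc.
Qed.

Lemma mul2C : commutative mul2.
Proof.
move=> a b; apply: agree_eq => N; exists (trunc2 N a * trunc2 N b).
  by apply: agree_mul; exact: agree_trunc.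
by rewrite mulrC; apply: agree_mul; exact: agree_trunc.
Qed.

Let agree_one N : agree N 1 one2.
Proof.
by move=> i j _ _; rewrite coef1 /=; case: eqP => _; rewrite ?coef1 ?coef0.
Qed.

Lemma mul12 : left_id one2 mul2.
Proof.
move=> a; apply: agree_eq => N; exists (1 * trunc2 N a).
  by apply: agree_mul; [exact: agree_one | exact: agree_trunc].
by rewrite mul1r; exact: agree_trunc.
Qed.

Lemma mul2Dl : left_distributive mul2 add2.
Proof.
move=> a b c; apply: series2P => i j /=; rewrite -big_split.
apply: eq_bigr => k _; rewrite -big_split; apply: eq_bigr => l _ /=.
exact: mulrDl.
Qed.

Lemma one2_neq0 : one2 != zero2.
Proof.
apply/eqP => /(congr1 (fun a => coef2 a 0 0))/= /eqP.
by rewrite oner_eq0.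
Qed.

HB.instance Definition _ :=
  GRing.isZmodule.Build (series2 K) add2A add2C add02 addN2.
HB.instance Definition _ := GRing.Zmodule_isComNzRing.Build (series2 K)
  mul2A mul2C mul12 mul2Dl one2_neq0.

End Series2Ring.

Section Convergent.
Variable K : numFieldType.
Implicit Types a b : series2 K.

(** Absolute summability on some closed polydisc of positive radius [r]. *)
Definition convergent2 a := exists r M : K, 0 < r /\
  forall N, \sum_(i < N) \sum_(j < N) `|coef2 a i j| * r ^+ (i + j) <= M.

Let bounded2 a (r M : K) := forall i j, `|coef2 a i j| * r ^+ (i + j) <= M.

Lemma convergent2P a :
  convergent2 a <-> exists r M : K, 0 < r /\ bounded2 a r M.
Proof.
split=> -[r [M [r0 rM]]].
  have t0 k l : 0 <= `|coef2 a k l| * r ^+ (k + l).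
    by apply: mulr_ge0 => //; apply: exprn_ge0; exact: ltW.
  exists r, M; split=> // i j.
  have iN : (i < (maxn i j).+1)%N by rewrite ltnS leq_maxl.
  have jN : (j < (maxn i j).+1)%N by rewrite ltnS leq_maxr.
  apply: le_trans (rM (maxn i j).+1).
  rewrite (bigD1 (Ordinal iN))//= (bigD1 (Ordinal jN))//= -addrA lerDl.
  by apply: addr_ge0; apply: sumr_ge0 => // k _; apply: sumr_ge0.
have M0 : 0 <= M.
  apply: le_trans (rM 0%N 0%N).
  by apply: mulr_ge0 => //; apply: exprn_ge0; exact: ltW.
have h0 : 0 <= (2^-1 : K) by rewrite invr_ge0.
have geo N : \sum_(i < N) (2^-1 : K) ^+ i <= 2.
  rewrite (_ : \sum_(i < N) _ = 2 * (1 - 2^-1 ^+ N)).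
    by rewrite ler_piMr// lerBlDr lerDl exprn_ge0.
  elim: N => [|N IH]; first by rewrite big_ord0 expr0 subrr mulr0.
  rewrite big_ord_recr /= {}IH exprS mulrBr mulrBr !mulr1 mulrA.
  rewrite (_ : 2 * 2^-1 = 1 :> K) ?divff ?pnatr_eq0// mul1r mulr_natl mulr2n.
  by rewrite opprD addrA addrNK.
exists (r / 2), (M * (2 * 2)); split; first by rewrite divr_gt0.
move=> N; apply: (@le_trans _ _
    (\sum_(i < N) \sum_(j < N) M * (2^-1 ^+ i * 2^-1 ^+ j))).
  apply: ler_sum => i _; apply: ler_sum => j _.
  rewrite exprMn mulrA (exprD 2^-1) ler_wpM2r// mulr_ge0// exprn_ge0.
under eq_bigr do rewrite -mulr_sumr -mulr_sumr.
rewrite -mulr_sumr ler_wpM2l// -mulr_suml ler_pM ?geo//;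
  by apply: sumr_ge0 => i _; rewrite exprn_ge0.
Qed.

Let bounded2_shrink a (r s M : K) :
  0 <= s -> s <= r -> bounded2 a r M -> bounded2 a s M.
Proof.
move=> s0 sr aM i j; apply: le_trans (aM i j); apply: ler_wpM2l => //.
by apply: lerXn2r => //; rewrite nnegrE// (le_trans s0).
Qed.

Let common_radius a b : convergent2 a -> convergent2 b ->
  exists r M M' : K, [/\ 0 < r, bounded2 a r M & bounded2 b r M'].
Proof.
move=> /convergent2P[r [M [r0 aM]]] /convergent2P[s [M' [s0 bM]]].
have rs0 : 0 < r + s by rewrite addr_gt0.
exists (r * s / (r + s)), M, M'; split.
- by rewrite divr_gt0// mulr_gt0.
- apply: bounded2_shrink aM; first by rewrite ltW// divr_gt0// mulr_gt0.
  by rewrite ler_pdivrMr// ler_wpM2l ?ltW// ltrDr.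
- apply: bounded2_shrink bM; first by rewrite ltW// divr_gt0// mulr_gt0.
  by rewrite ler_pdivrMr// mulrC ler_wpM2l ?ltW// ltrDl.
Qed.

Lemma convergent2_1 : convergent2 1.
Proof.
apply/convergent2P; exists 1, 1; split=> // i j.
by rewrite expr1n mulr1 /=; case: (_ && _); rewrite ?normr1 ?normr0.
Qed.

Lemma convergent2B a b : convergent2 a -> convergent2 b -> convergent2 (a - b).
Proof.
move=> ca cb; have [r [M [M' [r0 aM bM]]]] := common_radius ca cb.
apply/convergent2P; exists r, (M + M'); split=> // i j.
apply: le_trans (lerD (aM i j) (bM i j)); rewrite -mulrDl.
apply: ler_wpM2r; first by rewrite exprn_ge0 ?ltW.
exact: ler_normB.
Qed.

Lemma convergent2M a b : convergent2 a -> convergent2 b -> convergent2 (a * b).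
Proof.
move=> ca cb; have [r [M [M' [r0 aM bM]]]] := common_radius ca cb.
have r1 k : 0 <= r ^+ k by rewrite exprn_ge0// ltW.
have M0 : 0 <= M by apply: le_trans (aM 0%N 0%N); rewrite mulr_ge0.
have M'0 : 0 <= M' by apply: le_trans (bM 0%N 0%N); rewrite mulr_ge0.
apply/convergent2P; exists (r / 2), (M * M'); split; first by rewrite divr_gt0.
move=> i j; rewrite exprMn exprVn mulrA ler_pdivrMr ?exprn_gt0//.
apply: (@le_trans _ _
    (\sum_(k < i.+1) \sum_(l < j.+1) M * M')); last first.
  rewrite !sumr_const !card_ord -mulrnA -[leLHS]mulr_natr ler_wpM2l ?mulr_ge0//.
  by rewrite -natrX ler_nat mulnC expnD leq_mul// ltn_expl.
rewrite /= (le_trans (ler_wpM2r (r1 _) (ler_norm_sum _ _ _)))// mulr_suml.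
apply: ler_sum => k _.
rewrite (le_trans (ler_wpM2r (r1 _) (ler_norm_sum _ _ _)))// mulr_suml.
apply: ler_sum => l _; rewrite normrM.
have -> : (i + j = (k + l) + ((i - k) + (j - l)))%N.
  by rewrite addnACA !subnKC// -ltnS.
by rewrite exprD mulrACA ler_pM// mulr_ge0.
Qed.

Lemma convergent2_dominated (phi psi : nat -> nat) a b :
  (forall i, (phi i <= i)%N) -> (forall i, (psi i <= i)%N) ->
  (forall i j, `|coef2 b i j| <= `|coef2 a (phi i) (psi j)|) ->
  convergent2 a -> convergent2 b.
Proof.
move=> phi_le psi_le ba /convergent2P[r [M [r0 aM]]].
have r1 : 0 < 1 + r by rewrite addr_gt0.
have s0 : 0 < r / (1 + r) by rewrite divr_gt0.
apply/convergent2P; exists (r / (1 + r)), M; split=> // i j.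
have /(_ (phi i) (psi j)) : bounded2 a (r / (1 + r)) M.
  apply: bounded2_shrink aM; first exact: ltW.
  by rewrite ler_pdivrMr// ler_peMr ?ltW// ltrDl.
apply: le_trans; apply: ler_pM => //; first by rewrite exprn_ge0// ltW.
apply: ler_wiXn2l; [exact: ltW| |exact: leq_add].
by rewrite ler_pdivrMr// mul1r ltW// ltrDr.
Qed.

Definition convergent2_pred : {pred series2 K} :=
  fun a => `[< convergent2 a >].

Lemma convergent2_subring : subring_closed convergent2_pred.
Proof.
split=> [|a b|a b]; rewrite !inE.
- exact: convergent2_1.
- exact: convergent2B.
- exact: convergent2M.
Qed.

HB.instance Definition _ :=
  GRing.isSubringClosed.Build (series2 K) convergent2_pred convergent2_subring.

Record cseries2 := CSeries2 {
  cseries2_val :> series2 K;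
  _ : cseries2_val \in convergent2_pred }.

HB.instance Definition _ := [isSub for cseries2_val].
HB.instance Definition _ := [Choice of cseries2 by <:].
HB.instance Definition _ := [SubChoice_isSubComNzRing of cseries2 by <:].

Lemma cseries2_convergent (a : cseries2) : convergent2 a.
Proof. by case: a => a /= /asboolP. Qed.

Definition cseries2_of a (ca : convergent2 a) : cseries2 :=
  CSeries2 (asboolT ca).

End Convergent.

Section SeriesOperations.
Variable K : numFieldType.
Implicit Types a : cseries2 K.

Fact monomial2_subproof (d1 d2 : nat) :
  convergent2 (Series2 (fun i j => ((i == d1) && (j == d2))%:R : K)).
Proof.
apply/convergent2P; exists 1, 1; split=> // i j.
by rewrite expr1n mulr1 /=; case: (_ && _); rewrite ?normr1 ?normr0.
Qed.

(** [x1 ^ d1 * x2 ^ d2] *)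
Definition monomial2 (d1 d2 : nat) : cseries2 K :=
  cseries2_of (monomial2_subproof d1 d2).

Fact ramify_subproof (n : nat) a : convergent2 (Series2 (fun i j =>
  if (n %| i)%N && (n %| j)%N then coef2 a (i %/ n) (j %/ n) else 0)).
Proof.
apply: (@convergent2_dominated _ (divn^~ n) (divn^~ n) a); last 1 first.
- exact: cseries2_convergent.
- by move=> i; exact: leq_div.
- by move=> i; exact: leq_div.
- by move=> i j /=; case: ifP => // _; rewrite normr0.
Qed.

(** The ring [K{x1^(1/n), x2^(1/n)}] is represented by [K{y1, y2}] with
    [y_k = x_k^(1/n)]; [ramify n] is the inclusion of [K{x1, x2}] into it,
    [a(x1, x2) |-> a(y1^n, y2^n)]. *)
Definition ramify (n : nat) a : cseries2 K := cseries2_of (ramify_subproof n a).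

End SeriesOperations.

Definition is_unit (A : comNzRingType) (a : A) := exists b, a * b = 1.

Definition irreducible_elt (A : comNzRingType) (a : A) :=
  [/\ a != 0, ~ is_unit a &
      forall b c, a = b * c -> is_unit b \/ is_unit c].

Section QuasiOrdinary.
Variable K : numFieldType.
Implicit Types f q : {poly cseries2 K}.

Definition weierstrass f :=
  f \is monic /\ forall i, (i < (size f).-1)%N -> coef2 f`_i 0 0 = 0.

(** For monic [f] the resultant of [f] and its derivative is the discriminant
    up to sign. *)
Definition quasi_ordinary f := exists (d1 d2 : nat) (u : cseries2 K),
  is_unit u /\ resultant f f^`() = monomial2 K d1 d2 * u.

(** [xi] in [K{x1^(1/n), x2^(1/n)}] is a root of [q] in [K{x1, x2}[z]]. *)
Definition frac_root (n : nat) q (xi : cseries2 K) :=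
  root (map_poly (ramify n) q) xi.

Definition min_poly (n : nat) (xi : cseries2 K) q :=
  [/\ q \is monic, frac_root n q xi &
      forall h : {poly cseries2 K}, h != 0 -> frac_root n h xi ->
        (size q <= size h)%N].

End QuasiOrdinary.

Definition le_exp (u v : rat * rat) := (u.1 <= v.1) && (u.2 <= v.2).

(** In what follows, [lam j] is the characteristic exponent [lambda_j] for
    [1 <= j <= g], [lam 0 = 0], and the values [lam j] for [j > g] are
    irrelevant: [lambda_(g+1) = oo] is rendered by the guards [j < g]. *)

(** [M_j = Z^2 + Z lambda_1 + ... + Z lambda_j] *)
Fixpoint latM (lam : nat -> rat * rat) (j : nat) : set (rat * rat) :=
  if j is j'.+1
  then [set v | exists2 w, latM lam j' w & exists k : int, v = w + lam j *~ k]
  else [set v | v.1 \is a Num.int /\ v.2 \is a Num.int].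

(** The index [[A : B]] of lattices [B] in [A]: the number of cosets of [B] in
    [A] ([0] if infinite). *)
Definition lat_index (A B : set (rat * rat)) : nat :=
  #|` fset_set [set [set y | B (y - x)] | x in A] |%fset.

Definition idx (lam : nat -> rat * rat) (j : nat) : nat :=
  lat_index (latM lam j) (latM lam j.-1).

(** [prod_idx lam j k = n_j ... n_k] *)
Definition prod_idx (lam : nat -> rat * rat) (j k : nat) : nat :=
  (\prod_(j <= i < k.+1) idx lam i)%N.

(** [gamma_1 = lambda_1], [gamma_(j+1) = n_j gamma_j + lambda_(j+1) - lambda_j];
    the value at [0] is irrelevant. *)
Fixpoint gamma_exp (lam : nat -> rat * rat) (j : nat) : rat * rat :=
  match j with
  | 0 => 0
  | j'.+1 => if j' == 0%N then lam 1%N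
             else gamma_exp lam j' *+ idx lam j' + lam j - lam j'
  end.

Definition pairing (nu : nat * nat) (v : rat * rat) : rat :=
  nu.1%:R * v.1 + nu.2%:R * v.2.

(** The points of [N_j] in the cone [sigma]; [nu : nat * nat] ranges over
    [sigma] intersected with [Z^2]. *)
Definition sigma_latN (lam : nat -> rat * rat) (j : nat) : set (nat * nat) :=
  [set nu | forall v, latM lam j v -> pairing nu v \is a Num.int].

Section CharacteristicExponents.
Variable K : numFieldType.
Implicit Types zeta : cseries2 K.

(** The coefficient [beta_v] of [x^v] in [zeta]; it is zero unless
    [v] is in [(1/n) N^2]. *)
Definition beta (n : nat) zeta (v : rat * rat) : K :=
  if (n%:R * v.1 \is a Num.nat) && (n%:R * v.2 \is a Num.nat)
  then coef2 zeta (Num.truncn (n%:R * v.1)) (Num.truncn (n%:R * v.2)) else 0.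

Record char_exponents (n : nat) zeta (g : nat) (lam : nat -> rat * rat) : Prop := {
  char_gt0 : (0 < g)%N ;
  char_lam0 : lam 0%N = 0 ;
  char_lam1 : lam 1%N <> 0 ;
  char_le : forall j, (0 < j < g)%N -> le_exp (lam j) (lam j.+1) ;
  char_beta : forall j, (0 < j <= g)%N -> beta n zeta (lam j) <> 0 ;
  char_supp : forall v, beta n zeta v <> 0 ->
    forall j, (j <= g)%N -> le_exp (lam j) v ->
      ((j < g)%N -> ~~ le_exp (lam j.+1) v) -> latM lam j v ;
  char_notin : forall j, (0 < j <= g)%N -> ~ latM lam j.-1 (lam j) }.

(** The standing assumptions: lexicographic ordering of the coordinates,
    normalization, and no terms whose exponent is not [>= lambda_1]. *)
Record normalized_exponents (n : nat) zeta (g : nat) (lam : nat -> rat * rat)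
    : Prop := {
  norm_lex : (([seq (lam j).2 | j <- iota 1 g] : seqlexi rat) <=
              ([seq (lam j).1 | j <- iota 1 g] : seqlexi rat))%O ;
  norm_lam1 : ~ ((lam 1%N).2 = 0 /\ (lam 1%N).1 < 1) ;
  norm_supp : forall v, beta n zeta v <> 0 -> le_exp (lam 1%N) v }.

Definition frac_exp (n i j : nat) : rat * rat := (i%:R / n%:R, j%:R / n%:R).

Fact trunc_root_subproof n zeta g lam j :
  convergent2 (Series2 (fun k l =>
    if (j < g)%N && le_exp (lam j.+1) (frac_exp n k l) then 0
    else coef2 zeta k l)).
Proof.
apply: (@convergent2_dominated _ id id zeta) => //; last first.
  exact: cseries2_convergent.
by move=> k l /=; case: ifP => // _; rewrite normr0.
Qed.

(** [zeta_j], the sum of the terms of [zeta] whose exponent is not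
    [>= lambda_(j+1)]. *)
Definition trunc_root n zeta g lam j : cseries2 K :=
  cseries2_of (trunc_root_subproof n zeta g lam j).

End CharacteristicExponents.

Section Jets.
Variable K : numFieldType.

(** A closed point of [A^3_m]: a triple of elements of [K[t]/(t^(m+1))], each
    represented by a polynomial of degree at most [m]. *)
Record jet (m : nat) := Jet {
  jx1 : {poly_(m.+1) K} ;
  jx2 : {poly_(m.+1) K} ;
  jz : {poly_(m.+1) K} }.

(** The truncation [pi^a_(m,p)], for [p <= m]. *)
Definition jet_trunc (m p : nat) (c : jet m) : jet p :=
  Jet (npolyp p.+1 (jx1 c)) (npolyp p.+1 (jx2 c)) (npolyp p.+1 (jz c)).

Definition centered (r : K) (m : nat) (c : jet m) :=
  [/\ `|(jx1 c)`_0| < r, `|(jx2 c)`_0| < r & `|(jz c)`_0| < r].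

(** The composite of [c] with the truncation at order [N] in [x1] and [x2] of
    the coefficients of [f]. *)
Definition comp_partial (f : {poly cseries2 K}) (m : nat) (c : jet m) (N : nat)
    : {poly K} :=
  \sum_(i < size f) \sum_(k < N) \sum_(l < N)
    coef2 f`_i k l *:
      ((jx1 c : {poly K}) ^+ k * (jx2 c : {poly K}) ^+ l *
       (jz c : {poly K}) ^+ i).

(** [f] o [c] = 0 mod [t^(m+1)]: for [s <= m], the power series giving the
    coefficient of [t^s] in [f] o [c], which converges when the center of [c] is
    close to the origin, has sum [0].  The center of [c] need not be the origin,
    so this is not a finite sum. *)
Definition jet_vanish (f : {poly cseries2 K}) (m : nat) (c : jet m) :=
  forall s, (s <= m)%N -> (fun N => (comp_partial f c N)`_s) @ \oo --> (0 : K).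

(** The [m]-jets, centered in the polydisc of radius [r], of the germ [f = 0]. *)
Definition jet_scheme (r : K) (f : {poly cseries2 K}) (m : nat) : set (jet m) :=
  [set c | centered r c /\ jet_vanish f c].

(** The class of [p] modulo [t^(m+1)] has order [k]; for [p] of degree at most
    [m] this forces [k <= m], the class [0] having no order. Hence [jet_D] at
    level [p] is empty unless both coordinates of [nu] are at most [p], and it is
    only meaningful for such [nu]. *)
Definition t_order (p : {poly K}) (k : nat) :=
  p`_k <> 0 /\ forall i, (i < k)%N -> p`_i = 0.

Definition jet_D (r : K) (f : {poly cseries2 K}) (m : nat) (nu : nat * nat)
    : set (jet m) :=
  [set c | [/\ jet_scheme r f c, t_order (jx1 c) nu.1 & t_order (jx2 c) nu.2]].

End Jets.

(* Main.v *)
Require Import Defs.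
From HB Require Import structures.
From mathcomp Require Import all_boot all_order all_algebra.
From mathcomp Require separable cyclotomic cyclic.
From mathcomp Require Import finmap all_classical all_reals all_analysis.
From mathcomp Require Import complex ring lra.
Set Implicit Arguments.
Unset Strict Implicit.
Unset Printing Implicit Defensive.
Import Order.TTheory GRing.Theory Num.Theory.
Import numFieldNormedType.Exports.
Local Open Scope classical_set_scope.
Local Open Scope ring_scope.

(** Along a jet with [ord x_k = nu_k], put [t = s^n] and choose [y_k (s)] with
    [y_k^n = x_k (s^n)]. Then [f^n] becomes the product of [z - e zeta (y1, y2)]
    over the [n^2] pairs [e] of [n]-th roots of unity acting on [(y1, y2)], and a
    power of [F_j] the product of the [z - e zeta_j (y1, y2)]. All terms of
    [zeta - zeta_j] have exponent [>= lambda_(j+1)]. Hence there are two cases.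
    Either corresponding factors have equal orders, so that
    [ord f = e_j ord F_j]. Or some [z - e zeta_j] has [s]-order at least
    [n <nu, lambda_(j+1)>]; then counting the conjugates by their contact with
    [e zeta_j] gives [ord F_j >= <nu, gamma_(j+1)>] and
    [ord f >= e_j <nu, gamma_(j+1)>], and both jets vanish. The counts are the
    orders of the groups of [e] acting trivially on [M_k], which are related to
    the indices [n_k] by duality of finite abelian groups. *)

(** * Substitution into convergent power series *)

(** The obstacle is that a jet need not be centered at the origin. When some nu_k is 0, the
    composite of f with the jet is a convergent series instead of a finite sum, and evaluation
    respects sums and products only on series summable at a fixed radius. Hence everything happens
    at one radius [rho] at which zeta is summable. Conjugates and truncations of zeta have
    coefficients of no larger modulus, so they are summable there too, and so are the coefficients
    of f and of every F_j, being polynomials in conjugates. This is why one r0 serves all j, m and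
    nu. The roots y_k are in general power series, but polynomials that agree with them up to s^(nm)
    suffice. The price is that the evaluated series lies in K[[s^n]] only up to that order. The
    exponents of the two products are orders of stabilizers in (Z/n)^2: n for zeta and n e_j for
    zeta_j, whence f^n and F_j^(n e_j). An s-order is n times a t-order, so a total contact above n
    n m puts f beyond t^m and F_j beyond t^[m/e_j]. *)

Record seminorm (K : numFieldType) (A : comNzRingType) (nu : A -> K) : Prop :=
  Seminorm {
    seminorm0 : nu 0 = 0 ;
    seminorm_ge0 : forall a, 0 <= nu a ;
    seminormD : forall a b, nu (a + b) <= nu a + nu b ;
    seminormM : forall a b, nu (a * b) <= nu a * nu b }.

Lemma seminorm_norm (K : numFieldType) : seminorm (@Num.norm K K).
Proof.
split=> [|a|a b|a b]; [exact: normr0|exact: normr_ge0|exact: ler_normD|].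
by rewrite normrM.
Qed.

(** * Weighted norms on polynomials *)

Section PolyNorm.
Variables (K : numFieldType) (A : comNzRingType) (nu : A -> K) (rho : K).
Hypotheses (nuP : seminorm nu) (rho0 : 0 <= rho).
Implicit Types p q : {poly A}.

(** The l^1 norm in which the variable has norm [rho]. Coefficients in an arbitrary seminormed ring
    allow iteration: [norm1] is the coefficient norm of [norm2]. *)
Definition poly_norm p := \sum_(i < size p) nu p`_i * rho ^+ i.

Lemma poly_norm_wide N p : (size p <= N)%N ->
  poly_norm p = \sum_(i < N) nu p`_i * rho ^+ i.
Proof.
move=> pN; rewrite /poly_norm (big_ord_widen N (fun i => nu p`_i * rho ^+ i))//.
rewrite big_mkcond; apply: eq_bigr => i _; case: ltnP => // /(nth_default 0) ->.
by rewrite (seminorm0 nuP) mul0r.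
Qed.

Lemma poly_norm_ge0 p : 0 <= poly_norm p.
Proof.
apply: sumr_ge0 => i _; apply: mulr_ge0; first exact: (seminorm_ge0 nuP).
exact: exprn_ge0.
Qed.

Lemma poly_norm0 : poly_norm 0 = 0.
Proof. by rewrite /poly_norm size_poly0 big_ord0. Qed.

Lemma poly_normD p q : poly_norm (p + q) <= poly_norm p + poly_norm q.
Proof.
rewrite (poly_norm_wide (size_polyD p q)) (poly_norm_wide (leq_maxl _ (size q))).
rewrite (poly_norm_wide (leq_maxr (size p) _)) -big_split; apply: ler_sum => i _.
rewrite coefD /= -mulrDl ler_wpM2r ?exprn_ge0//; exact: (seminormD nuP).
Qed.

Lemma poly_norm_cons p c :
  poly_norm (p * 'X + c%:P) = poly_norm p * rho + nu c.
Proof.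
have sz : (size (p * 'X + c%:P)%R <= (size p).+1)%N.
  by rewrite -cons_poly_def size_cons_poly; case: ifP.
rewrite (poly_norm_wide sz) big_ord_recl /= expr0 mulr1.
rewrite coefD coefMX coefC /= add0r addrC; congr (_ + _).
rewrite /poly_norm mulr_suml; apply: eq_bigr => i _.
by rewrite coefD coefMX coefC /= addr0 exprSr mulrA.
Qed.

Lemma poly_normC c : poly_norm c%:P = nu c.
Proof. by rewrite -[c%:P]add0r -{1}(mul0r 'X) poly_norm_cons poly_norm0 mul0r
  add0r. Qed.

Lemma poly_norm_scale c p : poly_norm (c%:P * p) <= nu c * poly_norm p.
Proof.
have sz : (size (c%:P * p)%R <= size p)%N by rewrite mul_polyC size_scale_leq.
rewrite (poly_norm_wide sz) mulr_sumr; apply: ler_sum => i _.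
by rewrite coefCM mulrA ler_wpM2r ?exprn_ge0//; exact: (seminormM nuP).
Qed.

Lemma poly_normM p q : poly_norm (p * q) <= poly_norm p * poly_norm q.
Proof.
elim/poly_ind: p => [|p c IH]; first by rewrite !mul0r poly_norm0 mul0r.
rewrite mulrDl mulrAC; apply: le_trans (poly_normD _ _) _.
rewrite poly_norm_cons mulrDl; apply: lerD; last exact: poly_norm_scale.
by rewrite -[p * q * 'X]addr0 -polyC0 poly_norm_cons (seminorm0 nuP) addr0 mulrAC
  ler_wpM2r.
Qed.

Lemma seminorm_poly : seminorm poly_norm.
Proof.
split; [exact: poly_norm0|exact: poly_norm_ge0|exact: poly_normD|exact: poly_normM].
Qed.

Lemma poly_norm_coef p i : nu p`_i * rho ^+ i <= poly_norm p.
Proof.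
have [pi|ip] := leqP (size p) i.
  by rewrite nth_default// (seminorm0 nuP) mul0r poly_norm_ge0.
rewrite /poly_norm (bigD1 (Ordinal ip))//= lerDl; apply: sumr_ge0 => k _.
by rewrite mulr_ge0 ?exprn_ge0//; exact: (seminorm_ge0 nuP).
Qed.

(** Horner's scheme: each step multiplies the bound by at most [rho]. *)
Lemma seminorm_horner_le (B : comNzRingType) (mu : B -> K)
    (phi : {rmorphism A -> B}) (b : B) p :
  seminorm mu -> (forall a, mu (phi a) <= nu a) -> mu b <= rho ->
  mu (map_poly phi p).[b] <= poly_norm p.
Proof.
move=> muP phile ble; elim/poly_ind: p => [|p c IH].
  by rewrite rmorph0 horner0 (seminorm0 muP) poly_norm0.
rewrite rmorphD rmorphM /= map_polyX map_polyC hornerMXaddC poly_norm_cons.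
apply: le_trans (seminormD muP _ _) _; apply: lerD; last exact: phile.
apply: le_trans (seminormM muP _ _) _.
by apply: ler_pM => //; exact: (seminorm_ge0 muP).
Qed.

End PolyNorm.

Section Norm2.
Variable K : numFieldType.
Implicit Types (p q : {poly {poly K}}) (a b : series2 K).

Definition norm1 (rho : K) : {poly K} -> K := poly_norm (@Num.norm K K) rho.
Definition norm2 (rho : K) : {poly {poly K}} -> K := poly_norm (norm1 rho) rho.

Lemma seminorm1 rho : 0 <= rho -> seminorm (norm1 rho).
Proof. by move=> r0; apply: seminorm_poly r0; exact: seminorm_norm. Qed.

Lemma seminorm2 rho : 0 <= rho -> seminorm (norm2 rho).
Proof. by move=> r0; apply: (seminorm_poly _ r0); exact: seminorm1. Qed.

Definition box_sum rho N (c : nat -> nat -> K) :=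
  \sum_(i < N) \sum_(j < N) `|c i j| * rho ^+ (i + j).

Lemma norm2_box rho N p : 0 <= rho -> (size p <= N)%N ->
  (forall i, (size (p`_i)%R <= N)%N) -> norm2 rho p = box_sum rho N (fun i j =>
    (p`_i)`_j).
Proof.
move=> r0 pN piN; rewrite /norm2 (poly_norm_wide _ (seminorm1 r0) pN).
apply: eq_bigr => i _; rewrite /norm1 (poly_norm_wide _ (seminorm_norm K) (piN i)).
by rewrite mulr_suml; apply: eq_bigr => j _; rewrite -mulrA -exprD addnC.
Qed.

Lemma box_bound p : exists N, (size p <= N)%N /\ (forall i, (size (p`_i)%R <= N)%N).
Proof.
exists (maxn (size p) (\max_(i < size p) size (p`_i)%R)).
split=> [|i]; first exact: leq_maxl.
have [pi|ip] := leqP (size p) i; first by rewrite (nth_default 0 pi) size_poly0.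
rewrite leq_max; apply/orP; right.
exact: (@leq_bigmax _ (fun i : 'I_(size p) => size (p`_i)%R) (Ordinal ip)).
Qed.

Lemma norm2_le theta rho c p q : 0 <= theta -> 0 <= rho ->
  (forall i j, `|p`_i`_j| * theta ^+ (i + j) <= c * (`|q`_i`_j| * rho ^+ (i + j))) ->
  norm2 theta p <= c * norm2 rho q.
Proof.
move=> t0 r0 pq; have [N1 [p1 p2]] := box_bound p; have [N2 [q1 q2]] := box_bound q.
rewrite (@norm2_box theta (maxn N1 N2))//; last 2 first.
- by rewrite (leq_trans p1) ?leq_maxl.
- by move=> i; rewrite (leq_trans (p2 i)) ?leq_maxl.
rewrite (@norm2_box rho (maxn N1 N2))//; last 2 first.
- by rewrite (leq_trans q1) ?leq_maxr.
- by move=> i; rewrite (leq_trans (q2 i)) ?leq_maxr.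
rewrite /box_sum mulr_sumr; apply: ler_sum => i _; rewrite mulr_sumr.
by apply: ler_sum => j _; exact: pq.
Qed.

Definition trunc2 N a : {poly {poly K}} :=
  \poly_(i < N) \poly_(j < N) coef2 a i j.

Lemma coef_trunc2 N a i j :
  (trunc2 N a)`_i`_j = if (i < N)%N && (j < N)%N then coef2 a i j else 0.
Proof.
rewrite coef_poly; case: ifP => _; last by rewrite coef0.
by rewrite coef_poly.
Qed.

Lemma poly2P p q : (forall i j, p`_i`_j = q`_i`_j) -> p = q.
Proof. by move=> pq; apply/polyP => i; apply/polyP => j. Qed.

Lemma trunc2D N a b : trunc2 N (a + b) = trunc2 N a + trunc2 N b.
Proof.
apply: poly2P => i j; rewrite !coefD !coef_trunc2.
by case: ifP => // _; rewrite addr0.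
Qed.

Lemma trunc2_0 N : trunc2 N 0 = 0.
Proof. by apply: poly2P => i j; rewrite coef_trunc2 !coef0 if_same. Qed.

Lemma trunc2_1 N : (0 < N)%N -> trunc2 N 1 = 1.
Proof.
move=> N0; apply: poly2P => i j; rewrite coef_trunc2 !coef1 /=.
case: i => [|i]; case: j => [|j]; rewrite ?N0 ?coef1 ?coef0 ?andbF ?if_same//=.
Qed.

(** A coefficient of a product involves only coefficients of indices at most its own, so truncation
    is multiplicative inside the box. The error lies outside, where halving the radius makes it
    small. *)
Lemma coef_trunc2M N a b i j : (i < N)%N -> (j < N)%N ->
  (trunc2 N a * trunc2 N b)`_i`_j = coef2 (a * b) i j.
Proof.
move=> iN jN; rewrite coefM coef_sum; apply: eq_bigr => k _ /=.
rewrite coefM; apply: eq_bigr => l _; rewrite !coef_trunc2.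
have kN : (k < N)%N by apply: leq_ltn_trans iN; rewrite -ltnS.
have lN : (l < N)%N by apply: leq_ltn_trans jN; rewrite -ltnS.
by rewrite kN lN !(leq_ltn_trans (leq_subr _ _)).
Qed.

(** Unlike convergence on an unspecified polydisc, this is stable under products
    at a fixed radius. *)
Definition summable2 rho a := exists M, forall N, norm2 rho (trunc2 N a) <= M.

Lemma norm2_trunc rho N a : 0 <= rho ->
  norm2 rho (trunc2 N a) = box_sum rho N (coef2 a).
Proof.
move=> r0; rewrite (@norm2_box _ N)//; last 2 first.
- exact: size_poly.
- move=> i; rewrite coef_poly; case: ifP => _; last by rewrite size_poly0.
  exact: size_poly.
apply: eq_bigr => i _; apply: eq_bigr => j _.
by rewrite coef_trunc2 !ltn_ord.
Qed.

Lemma convergent2_summable a : convergent2 a ->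
  exists2 rho, 0 < rho & summable2 rho a.
Proof.
move=> [r [M [r0 aM]]]; exists r => //; exists M => N.
by rewrite norm2_trunc; [exact: aM | exact: ltW].
Qed.

Section Summable.
Variable rho : K.
Hypothesis rho0 : 0 < rho.
Let rho_ge0 : 0 <= rho := ltW rho0.

Lemma summable2_le a b : (forall i j, `|coef2 b i j| <= `|coef2 a i j|) ->
  summable2 rho a -> summable2 rho b.
Proof.
move=> ba [M aM]; exists M => N; apply: le_trans (aM N).
rewrite !norm2_trunc//; apply: ler_sum => i _; apply: ler_sum => j _.
by rewrite ler_wpM2r ?exprn_ge0.
Qed.

Lemma summable2_0 : summable2 rho 0.
Proof. by exists 0 => N; rewrite trunc2_0 (seminorm0 (seminorm2 rho_ge0)). Qed.

Lemma summable2_1 : summable2 rho 1.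
Proof.
exists 1 => -[|N].
  by rewrite norm2_trunc// /box_sum big_ord0.
rewrite trunc2_1// /norm2 (poly_normC _ (seminorm1 rho_ge0)) /norm1.
by rewrite (poly_normC _ (seminorm_norm K)) normr1.
Qed.

Lemma summable2D a b : summable2 rho a -> summable2 rho b -> summable2 rho (a + b).
Proof.
move=> [M aM] [M' bM]; exists (M + M') => N; rewrite trunc2D.
apply: le_trans (seminormD (seminorm2 rho_ge0) _ _) _.
exact: lerD.
Qed.

Lemma summable2N a : summable2 rho a -> summable2 rho (- a).
Proof. by apply: summable2_le => i j; rewrite normrN. Qed.

Lemma summable2M a b : summable2 rho a -> summable2 rho b -> summable2 rho (a * b).
Proof.
move=> [M aM] [M' bM]; exists (M * M') => N.
apply: (@le_trans _ _ (1 * norm2 rho (trunc2 N a * trunc2 N b))).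
  apply: norm2_le => // i j; rewrite mul1r coef_trunc2.
  case: ifP => [/andP[iN jN]|_]; first by rewrite coef_trunc2M.
  by rewrite normr0 mul0r mulr_ge0 ?exprn_ge0.
rewrite mul1r; apply: le_trans (seminormM (seminorm2 rho_ge0) _ _) _.
by apply: ler_pM => //; exact: (seminorm_ge0 (seminorm2 rho_ge0)).
Qed.

Lemma summable2_sum (I : Type) (r : seq I) (P : pred I) (F : I -> series2 K) :
  (forall i, P i -> summable2 rho (F i)) -> summable2 rho (\sum_(i <- r | P i) F i).
Proof. by move=> FP; elim/big_ind: _ => //;
  [exact: summable2_0|exact: summable2D]. Qed.

(** Halving the radius turns summability into geometric convergence of the
    square partial sums. *)
Lemma norm2_half_outside N (p q : {poly {poly K}}) :
  (forall i j, (i < N)%N -> (j < N)%N -> p`_i`_j = 0) ->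
  (forall i j, `|p`_i`_j| <= `|q`_i`_j|) ->
  norm2 (rho / 2) p <= 2^-1 ^+ N * norm2 rho q.
Proof.
move=> p0 pq; have h0 : 0 <= (2^-1 : K) by rewrite invr_ge0.
apply: norm2_le => //; first by rewrite mulr_ge0.
move=> i j; have [/andP[iN jN]|] := boolP ((i < N) && (j < N))%N.
  by rewrite p0// normr0 mul0r mulr_ge0 ?exprn_ge0// mulr_ge0 ?exprn_ge0.
rewrite negb_and -!leqNgt => ijN.
have Nij : (N <= i + j)%N.
  by case/orP: ijN => /leq_trans; apply; rewrite ?leq_addr ?leq_addl.
rewrite exprMn [leLHS]mulrA [leLHS]mulrC; apply: ler_pM;
  rewrite ?exprn_ge0 ?mulr_ge0 ?exprn_ge0//; last first.
  by rewrite ler_wpM2r ?exprn_ge0.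
by rewrite ler_wiXn2l// invf_le1// ler1n.
Qed.

End Summable.
End Norm2.

(** * Limits with geometric rate *)

Section GeometricLimit.
Variable K : numFieldType.
Implicit Types (u v : nat -> K) (l : K).

(** With an explicit rate, sums, products and subsequences need only elementary estimates. Smallness
    of 2^-N enters in [geom_lim_cvg], where topological convergence is deduced. *)
Definition geom_lim u l := exists C, forall N, `|u N - l| <= C * 2^-1 ^+ N.

Let half_ge0 : 0 <= (2^-1 : K). Proof. by rewrite invr_ge0. Qed.
Let halfX_ge0 N : 0 <= (2^-1 ^+ N : K). Proof. exact: exprn_ge0. Qed.
Let halfX_le1 N : (2^-1 ^+ N : K) <= 1.
Proof. by rewrite exprn_ile1// invf_le1// ler1n. Qed.

Let bound_ge0 u l C : (forall N, `|u N - l| <= C * 2^-1 ^+ N) -> 0 <= C.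
Proof. by move/(_ 0%N); rewrite expr0 mulr1; exact: le_trans. Qed.

Lemma geom_lim_cst l : geom_lim (fun=> l) l.
Proof. by exists 0 => N; rewrite subrr normr0 mul0r. Qed.

Lemma geom_lim_ext u v l : (forall N, u N = v N) -> geom_lim u l -> geom_lim v l.
Proof. by move=> uv [C uC]; exists C => N; rewrite -uv. Qed.

Lemma geom_limD u v l l' : geom_lim u l -> geom_lim v l' ->
  geom_lim (fun N => u N + v N) (l + l').
Proof.
move=> [C uC] [C' vC]; exists (C + C') => N.
rewrite opprD addrACA mulrDl; apply: le_trans (ler_normD _ _) _.
exact: lerD.
Qed.

Lemma geom_limM u v l l' : geom_lim u l -> geom_lim v l' ->
  geom_lim (fun N => u N * v N) (l * l').
Proof.
move=> [C uC] [C' vC]; have C0 := bound_ge0 uC; have C'0 := bound_ge0 vC.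
exists (C * (C' + `|l'|) + `|l| * C') => N.
have -> : u N * v N - l * l' = (u N - l) * v N + l * (v N - l').
  by rewrite mulrBl mulrBr addrA subrK.
apply: le_trans (ler_normD _ _) _; rewrite !normrM mulrDl.
apply: lerD; last by rewrite -mulrA ler_wpM2l.
rewrite mulrAC; apply: ler_pM => //.
rewrite -[v N](subrK l'); apply: le_trans (ler_normD _ _) _.
by rewrite lerD2r; apply: le_trans (vC N) _; rewrite ler_piMr.
Qed.

Lemma geom_lim_sum (I : Type) (r : seq I) (u : I -> nat -> K) (l : I -> K) :
  (forall i, geom_lim (u i) (l i)) ->
  geom_lim (fun N => \sum_(i <- r) u i N) (\sum_(i <- r) l i).
Proof.
move=> ul; elim: r => [|i r IH].
  by rewrite big_nil; apply: geom_lim_ext (geom_lim_cst 0) => N; rewrite big_nil.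
rewrite big_cons; apply: geom_lim_ext (geom_limD (ul i) IH) => N.
by rewrite big_cons.
Qed.

Lemma geom_lim_sub u l (phi : nat -> nat) : (forall N, (N <= phi N)%N) ->
  geom_lim u l -> geom_lim (fun N => u (phi N)) l.
Proof.
move=> phiN [C uC]; have C0 := bound_ge0 uC; exists C => N.
apply: le_trans (uC _) _; rewrite ler_wpM2l// ler_wiXn2l//.
by rewrite invf_le1// ler1n.
Qed.

Lemma geom_lim_close u v l C : (forall N, `|u N - v N| <= C * 2^-1 ^+ N) ->
  geom_lim u l -> geom_lim v l.
Proof.
move=> uvC [C' uC']; exists (C + C') => N; rewrite mulrDl.
have -> : v N - l = - (u N - v N) + (u N - l) by rewrite opprB addrA subrK.
by apply: le_trans (ler_normD _ _) _; rewrite normrN lerD.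
Qed.

(** What is used of the completeness of the complex numbers. *)
Record geom_complete : Prop := GeomComplete {
  half_pow_small : forall C e : K, 0 <= C -> 0 < e ->
    exists N0, forall N, (N0 <= N)%N -> C * 2^-1 ^+ N < e ;
  geom_cauchy : forall u C, (forall N, `|u N.+1 - u N| <= C * 2^-1 ^+ N) ->
    exists l, geom_lim u l }.

Hypothesis Kcomplete : geom_complete.

Lemma geom_lim_cvg u l : geom_lim u l -> u @ \oo --> l.
Proof.
move=> [C uC]; apply/cvgrPdist_lt => e e0.
have [N0 N0P] := half_pow_small Kcomplete (bound_ge0 uC) e0.
exists N0 => // N /= N0N; rewrite distrC.
exact: le_lt_trans (uC N) (N0P N N0N).
Qed.

Lemma geom_lim_unique u l l' : geom_lim u l -> geom_lim u l' -> l = l'.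
Proof.
move=> /geom_lim_cvg ul /geom_lim_cvg ul'.
exact: (cvg_unique (@norm_hausdorff _ _) ul ul').
Qed.

End GeometricLimit.

Section ComplexLimit.
Variable R : realType.
Notation K := (R[i]).
Implicit Type u : nat -> K.

Lemma ge0_Re (z : K) : 0 <= z -> z = (complex.Re z)%:C%C.
Proof. by move=> /ger0_Im z0; case: z z0 => a b /= ->. Qed.

Lemma complex_half_pow_small (C e : K) : 0 <= C -> 0 < e ->
  exists N0, forall N, (N0 <= N)%N -> C * 2^-1 ^+ N < e.
Proof.
move=> C0 e0; exists (Num.Def.archi_bound (complex.Re (C / e))) => N /upper_nthrootP.
rewrite -ltcR -ge0_Re; last by rewrite divr_ge0// ltW.
rewrite rmorphXn rmorph_nat ltr_pdivrMr// => h.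
by rewrite exprVn ltr_pdivrMr ?exprn_gt0// mulrC.
Qed.

Lemma geom_cauchy_real (v : nat -> R) (C : R) :
  (forall N, `|v N.+1 - v N| <= C * 2^-1 ^+ N) ->
  exists l, forall N, `|v N - l| <= (2 * C) * 2^-1 ^+ N.
Proof.
move=> vC; have C0 : 0 <= C by have := vC 0%N; rewrite expr0 mulr1; exact: le_trans.
have C20 N : 0 <= 2 * C * 2^-1 ^+ N by rewrite !mulr_ge0// exprn_ge0// invr_ge0.
have step N : 2 * C * 2^-1 ^+ N = 2 * C * 2^-1 ^+ N.+1 + C * 2^-1 ^+ N.
  rewrite exprS; have -> : 2 * C * (2^-1 * 2^-1 ^+ N) = C * 2^-1 ^+ N.
    by rewrite [2 * C]mulrC -mulrA (mulrA 2) divff ?mul1r// pnatr_eq0.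
  by rewrite -mulrA mulr_natl mulr2n.
(* [2 * C * 2^-1 ^+ N] is the geometric tail C 2^-N + C 2^-(N+1) + ..., so the intervals from [a N]
   to [b N] are nested and the supremum of their left ends lies in all of them. *)
pose a N := v N - 2 * C * 2^-1 ^+ N; pose b N := v N + 2 * C * 2^-1 ^+ N.
have aS N : a N <= a N.+1.
  have := vC N; rewrite /a (step N) ler_norml => /andP[h _].
  by lra.
have bS N : b N.+1 <= b N.
  have := vC N; rewrite /b (step N) ler_norml => /andP[_ h].
  by lra.
have a_mono : {homo a : m n / (m <= n)%N >-> m <= n} by exact/nondecreasing_seqP.
have b_mono : {homo b : m n / (m <= n)%N >-> n <= m} by exact/nonincreasing_seqP.
have ab m n : a m <= b n.
  apply: (@le_trans _ _ (a (maxn m n))); first by rewrite a_mono// leq_maxl.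
  apply: (@le_trans _ _ (b (maxn m n))); last by rewrite b_mono// leq_maxr.
  by rewrite lerD2l; apply: le_trans (C20 _); rewrite oppr_le0.
exists (sup (range a)) => N; rewrite ler_distl.
have la : a N <= sup (range a).
  by apply: ub_le_sup; [exists (b 0%N) => _ [m _ <-]|exists N].
have lb : sup (range a) <= b N.
  by apply: ge_sup; [exists (a 0%N), 0%N|move=> _ [m _ <-]].
by move: la lb; rewrite /a /b => la lb; apply/andP; split; lra.
Qed.

Lemma norm_complex_le (a b c : R) : `|a| <= c -> `|b| <= c ->
  `|Complex a b| <= (2 * c)%:C%C :> K.
Proof.
move=> ac bc; rewrite (complexE (Complex a b)) /=; apply: le_trans (ler_normD _ _) _.
have nR (x : R) : `|x%:C%C| = `|x|%:C%C :> K.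
  by rewrite normc_def /= expr0n /= addr0 sqrtr_sqr.
rewrite normrM !nR; have -> : `|'i%C| = 1 :> K.
  by rewrite normc_def /= expr0n expr1n /= add0r sqrtr1.
by rewrite mul1r -rmorphD lecR mulrDl mul1r lerD.
Qed.

Lemma complex_geom_cauchy u C : (forall N, `|u N.+1 - u N| <= C * 2^-1 ^+ N) ->
  exists l, geom_lim u l.
Proof.
move=> uC; have C0 : 0 <= C by have := uC 0%N; rewrite expr0 mulr1; exact: le_trans.
have nC N : C * 2^-1 ^+ N = (complex.Re C * 2^-1 ^+ N)%:C%C.
  by rewrite {1}(ge0_Re C0) rmorphM rmorphXn /= fmorphV rmorph_nat.
have [a aP] : exists l, forall N,
    `|complex.Re (u N) - l| <= 2 * complex.Re C * 2^-1 ^+ N.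
  apply: geom_cauchy_real => N; rewrite -lecR -nC.
  apply: le_trans (uC N); apply: le_trans (normc_ge_Re _).
  by case: (u N) (u N.+1) => ? ? [].
have [b bP] : exists l, forall N,
    `|complex.Im (u N) - l| <= 2 * complex.Re C * 2^-1 ^+ N.
  apply: geom_cauchy_real => N; rewrite -lecR -nC.
  apply: le_trans (uC N).
  (* Multiplication by i keeps the modulus and turns the imaginary part, up to sign, into a real
     part. *)
  have -> : `|u N.+1 - u N| = `|(u N.+1 - u N) * 'i%C| :> K.
    rewrite normrM (_ : `|'i%C| = 1) ?mulr1//.
    by rewrite normc_def /= expr0n expr1n /= add0r sqrtr1.
  apply: le_trans (normc_ge_Re _); rewrite ReiNIm normrN.
  by case: (u N) (u N.+1) => ? ? [].
exists (Complex a b), (2 * (2 * C)) => N.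
rewrite -!mulrA nC mulrA; case: (u N) (aP N) (bP N) => x y /= xa yb.
apply: (le_trans (norm_complex_le xa yb)).
by rewrite -!mulrA !rmorphM !rmorph_nat.
Qed.

Lemma complex_geom_complete : geom_complete (R[i] : numFieldType).
Proof. by split; [exact: complex_half_pow_small|exact: complex_geom_cauchy]. Qed.

End ComplexLimit.

(** * Evaluation along a pair of polynomials *)

Section Substitution.
Variables (K : numFieldType) (Kcomplete : geom_complete K).
Variables (y1 y2 : {poly K}).

Definition subst2 (p : {poly {poly K}}) : {poly K} :=
  (map_poly (comp_poly y2) p).[y1].

Lemma subst2D p q : subst2 (p + q) = subst2 p + subst2 q.
Proof. by rewrite /subst2 rmorphD hornerD. Qed.

Lemma subst2B p q : subst2 (p - q) = subst2 p - subst2 q.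
Proof. by rewrite /subst2 rmorphB hornerD hornerN. Qed.

Lemma subst2M p q : subst2 (p * q) = subst2 p * subst2 q.
Proof. by rewrite /subst2 rmorphM hornerM. Qed.

Lemma subst2_1 : subst2 1 = 1.
Proof. by rewrite /subst2 rmorph1 hornerC. Qed.

Lemma subst2_trunc N a :
  subst2 (trunc2 N a) =
  \sum_(i < N) \sum_(j < N) coef2 a i j *: (y1 ^+ i * y2 ^+ j).
Proof.
rewrite /subst2 (horner_coef_wide (n := N)); last first.
  by rewrite (leq_trans (size_poly _ _))// size_poly.
apply: eq_bigr => i _; rewrite coef_map /= coef_poly ltn_ord.
rewrite /comp_poly (horner_coef_wide (n := N)) ?mulr_suml; last first.
  by rewrite (leq_trans (size_poly _ _))// size_poly.
apply: eq_bigr => j _; rewrite coef_map /= coef_poly ltn_ord mul_polyC.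
by rewrite -scalerAl mulrC.
Qed.

(** The formal power series ring [K[[s]]] is embedded in [series2 K] as the
    series in the first variable; [subst_series a] is the expansion in [s] of
    [a (y1 (s), y2 (s))]. *)
Definition subst_coef (a : series2 K) (q : nat) : K :=
  xget 0 [set l | geom_lim (fun N => (subst2 (trunc2 N a))`_q) l].

Definition subst_series (a : series2 K) : series2 K :=
  Series2 (fun q j => if j == 0%N then subst_coef a q else 0).

Variables (rho tau : K).
Hypotheses (rho0 : 0 < rho) (tau0 : 0 < tau).
Hypotheses (y1rho : norm1 tau y1 <= rho / 2) (y2rho : norm1 tau y2 <= rho / 2).

Let rho_ge0 : 0 <= rho := ltW rho0.
Let tau_ge0 : 0 <= tau := ltW tau0.

(** One application of the Horner bound per variable. Bounding [y1] and [y2] by [rho / 2] leaves the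
    factor 2 that yields geometric convergence for series summable at [rho]. *)
Lemma norm_subst2 p : norm1 tau (subst2 p) <= norm2 (rho / 2) p.
Proof.
have h0 : 0 <= rho / 2 by rewrite divr_ge0.
apply: (seminorm_horner_le (seminorm1 h0)) => //; first exact: seminorm1.
move=> r; apply: (seminorm_horner_le (seminorm_norm K)) => //.
  exact: seminorm1.
by move=> c /=; rewrite /norm1 (poly_normC _ (seminorm_norm K)).
Qed.

(** Reading off the coefficient of s^q costs a factor [tau ^+ q], a constant since q is fixed while
    N grows. *)
Lemma subst2_coef_small N q (p r : {poly {poly K}}) :
  (forall i j, (i < N)%N -> (j < N)%N -> p`_i`_j = 0) ->
  (forall i j, `|p`_i`_j| <= `|r`_i`_j|) ->
  `|(subst2 p)`_q| <= (norm2 rho r / tau ^+ q) * 2^-1 ^+ N.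
Proof.
move=> p0 pr; rewrite mulrAC ler_pdivlMr ?exprn_gt0//.
apply: le_trans (poly_norm_coef (seminorm_norm K) tau_ge0 _ _) _.
apply: le_trans (norm_subst2 p) _; rewrite [leRHS]mulrC.
exact: norm2_half_outside.
Qed.

Lemma subst_coefP a q : summable2 rho a ->
  geom_lim (fun N => (subst2 (trunc2 N a))`_q) (subst_coef a q).
Proof.
move=> [M aM].
have [l ul] : exists l, geom_lim (fun N => (subst2 (trunc2 N a))`_q) l.
  apply: (geom_cauchy Kcomplete (C := M / tau ^+ q)) => N.
  rewrite -coefB -subst2B.
  apply: (@le_trans _ _ (norm2 rho (trunc2 N.+1 a) / tau ^+ q * 2^-1 ^+ N)).
    apply: subst2_coef_small => i j.
      by move=> iN jN; rewrite 2!coefB !coef_trunc2 iN jN !ltnS (ltnW iN) (ltnW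
        jN) subrr.
    rewrite 2!coefB !coef_trunc2; case: ifP => [/andP[iN jN]|ijN].
      case: ifP => _; last by rewrite subr0.
      by rewrite subrr normr0.
    case: ifP => [/andP[iN jN]|_]; last by rewrite subr0.
    by rewrite !ltnS (ltnW iN) (ltnW jN) in ijN.
  by rewrite ler_wpM2r ?exprn_ge0 ?invr_ge0// ler_wpM2r// invr_ge0 exprn_ge0.
by rewrite /subst_coef; case: xgetP => [x ->//|/(_ l)].
Qed.

Lemma subst_coef_unique a q l : summable2 rho a ->
  geom_lim (fun N => (subst2 (trunc2 N a))`_q) l -> subst_coef a q = l.
Proof. by move=> /subst_coefP ha /(geom_lim_unique Kcomplete (ha q)). Qed.

Lemma subst_series0 : subst_series 0 = 0.
Proof.
apply: series2P => q j /=; case: eqP => // _.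
apply: subst_coef_unique; first exact: summable2_0.
apply: geom_lim_ext (geom_lim_cst 0) => N.
by rewrite trunc2_0 /subst2 rmorph0 horner0 coef0.
Qed.

Lemma subst_series1 : subst_series 1 = 1.
Proof.
apply: series2P => q j /=; rewrite andbC; case: eqP => //= _.
apply: subst_coef_unique; first exact: summable2_1.
(* The truncation of 1 at N = 0 is 0; the constant 1 absorbs this exceptional term. *)
exists 1 => -[|N]; last first.
  rewrite trunc2_1// subst2_1 coef1 subrr normr0 mul1r exprn_ge0// invr_ge0//.
rewrite (_ : trunc2 0 1 = 0) /subst2 ?rmorph0 ?horner0 ?coef0 ?sub0r ?normrN.
  by rewrite ?expr0 ?mulr1; case: (q == 0)%N; rewrite ?normr1 ?normr0.
by rewrite /trunc2 poly_def big_ord0.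
Qed.

Lemma subst_seriesD a b : summable2 rho a -> summable2 rho b ->
  subst_series (a + b) = subst_series a + subst_series b.
Proof.
move=> ga gb; apply: series2P => q j /=; case: eqP => _; last by rewrite addr0.
apply: subst_coef_unique; first exact: summable2D.
apply: geom_lim_ext (geom_limD (subst_coefP q ga) (subst_coefP q gb)) => N.
by rewrite trunc2D subst2D coefD.
Qed.

Lemma subst_seriesN a : summable2 rho a -> subst_series (- a) = - subst_series a.
Proof.
move=> ga; apply/eqP; rewrite -subr_eq0 opprK -subst_seriesD//.
  by rewrite addNr subst_series0.
exact: summable2N.
Qed.

Lemma subst_seriesM a b : summable2 rho a -> summable2 rho b ->
  subst_series (a * b) = subst_series a * subst_series b.
Proof.
move=> ga gb; apply: series2P => q j /=; case: eqP => [->|/eqP j0]; last first.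
  rewrite big1// => k _; rewrite big1// => l _.
  have [->|l0] := eqVneq (l : nat) 0%N; last by rewrite mul0r.
  by rewrite subn0 (negbTE j0) mulr0.
apply: subst_coef_unique; first exact: summable2M.
have [M aM] := ga; have [M' bM] := gb.
have lim_prod : geom_lim
    (fun N => (subst2 (trunc2 N a) * subst2 (trunc2 N b))`_q)
    (\sum_(k < q.+1) \sum_(l < 1) (if l == 0%N :> nat then subst_coef a k else 0) *
       (if (0 - l == 0)%N then subst_coef b (q - k) else 0)).
  apply: (@geom_lim_ext _ (fun N => \sum_(k < q.+1)
    (subst2 (trunc2 N a))`_k * (subst2 (trunc2 N b))`_(q - k))) => [N|].
    by rewrite coefM.
  apply: geom_lim_sum => k; rewrite big_ord1 /=.
  by apply: geom_limM; exact: subst_coefP.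
(* The product of the truncations and the truncation of the product agree inside the box of side N,
   so they have the same limit. *)
apply: (geom_lim_close (C := (M * M') / tau ^+ q)) lim_prod => N.
rewrite -subst2M -coefB -subst2B.
apply: (@le_trans _ _ (norm2 rho (trunc2 N a * trunc2 N b) / tau ^+ q * 2^-1 ^+ N)).
  apply: subst2_coef_small => i k.
    by move=> iN kN; rewrite 2!coefB coef_trunc2 iN kN coef_trunc2M// subrr.
  rewrite 2!coefB coef_trunc2; case: ifP => [/andP[iN kN]|_]; last by rewrite subr0.
  by rewrite coef_trunc2M// subrr normr0.
rewrite ler_wpM2r ?exprn_ge0 ?invr_ge0// ler_wpM2r ?invr_ge0 ?exprn_ge0//.
apply: le_trans (seminormM (seminorm2 rho_ge0) _ _) _.
by apply: ler_pM => //; exact: (seminorm_ge0 (seminorm2 rho_ge0)).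
Qed.

Lemma subst_series_sum (I : Type) (r : seq I) (F : I -> series2 K) :
  (forall i, summable2 rho (F i)) ->
  subst_series (\sum_(i <- r) F i) = \sum_(i <- r) subst_series (F i).
Proof.
move=> FP; elim: r => [|i r IH]; first by rewrite !big_nil subst_series0.
by rewrite !big_cons subst_seriesD ?IH//; exact: summable2_sum.
Qed.

(** For [a] in [K[[s]]], embedded as above, [a] has order at least [h]. *)
Definition vge (a : series2 K) h := forall q, (q < h)%N -> coef2 a q 0 = 0.

(** Every monomial that occurs becomes divisible by this power of s, hence so does every partial
    sum; the coefficients below it are limits of zero sequences. *)
Lemma vge_subst a v1 v2 w1 w2 : summable2 rho a ->
  (forall i j, coef2 a i j != 0 -> (v1 <= i)%N /\ (v2 <= j)%N) ->
  'X^w1 %| y1 -> 'X^w2 %| y2 -> vge (subst_series a) (w1 * v1 + w2 * v2).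
Proof.
move=> ga supp y1w y2w q qh /=; apply: subst_coef_unique => //.
apply: geom_lim_ext (geom_lim_cst 0) => N; rewrite subst2_trunc.
suff /dvdpP[r ->] : 'X^(w1 * v1 + w2 * v2) %|
    \sum_(i < N) \sum_(j < N) coef2 a i j *: (y1 ^+ i * y2 ^+ j).
  by rewrite coefMXn qh.
apply: (big_ind (fun p => 'X^(w1 * v1 + w2 * v2) %| p));
  [exact: dvdp0|exact: dvdp_add|].
move=> i _; apply: (big_ind (fun p => 'X^(w1 * v1 + w2 * v2) %| p));
  [exact: dvdp0|exact: dvdp_add|].
move=> j _; have [->|/supp[vi vj]] := eqVneq (coef2 a i j) 0.
  by rewrite scale0r dvdp0.
rewrite -mul_polyC dvdp_mull// exprD !exprM.
apply: dvdp_mul.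
  by apply: dvdp_trans (dvdp_exp2l _ vi) _; apply: dvdp_exp2r.
by apply: dvdp_trans (dvdp_exp2l _ vj) _; apply: dvdp_exp2r.
Qed.

End Substitution.

Section Val.
Variable K : numFieldType.
Implicit Types a b : cseries2 K.

Lemma val2_0 : val (0 : cseries2 K) = 0 :> series2 K. Proof. exact: rmorph0. Qed.
Lemma val2_1 : val (1 : cseries2 K) = 1 :> series2 K. Proof. exact: rmorph1. Qed.
Lemma val2B a b : val (a - b) = val a - val b. Proof. exact: rmorphB. Qed.
Lemma val2M a b : val (a * b) = val a * val b. Proof. exact: rmorphM. Qed.
Lemma val2_sum (I : Type) (r : seq I) (P : pred I) (F : I -> cseries2 K) :
  val (\sum_(i <- r | P i) F i) = \sum_(i <- r | P i) val (F i).
Proof. exact: rmorph_sum. Qed.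

End Val.

Section EvalPoly.
Variables (K : numFieldType) (Kcomplete : geom_complete K).
Variables (y1 y2 zs : {poly K}).
Implicit Types P Q : {poly cseries2 K}.

Definition poly_series (p : {poly K}) : series2 K :=
  Series2 (fun q j => if j == 0%N then p`_q else 0).

Lemma poly_series1 : poly_series 1 = 1.
Proof. by apply: series2P => q j /=; rewrite andbC coef1; case: eqP. Qed.

Lemma poly_seriesM p q : poly_series (p * q) = poly_series p * poly_series q.
Proof.
apply: series2P => i j /=; case: eqP => [->|/eqP j0].
  by rewrite coefM; apply: eq_bigr => k _; rewrite big_ord1.
rewrite big1// => k _; rewrite big1// => l _.
have [->|l0] := eqVneq (l : nat) 0%N; last by rewrite mul0r.
by rewrite subn0 (negbTE j0) mulr0.
Qed.

Lemma poly_seriesX p k : poly_series (p ^+ k) = poly_series p ^+ k.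
Proof.
by elim: k => [|k IH]; rewrite ?expr0 ?poly_series1// !exprS poly_seriesM IH.
Qed.

(** [subst_series] is a morphism only on summable series, so the multiplicativity of this map is
    proved by hand for [summable_poly] arguments. *)
Definition eval_poly P : series2 K :=
  (map_poly (fun a : cseries2 K => subst_series y1 y2 (val a)) P).[poly_series zs].

Variables (rho tau : K).
Hypotheses (rho0 : 0 < rho) (tau0 : 0 < tau).
Hypotheses (y1rho : norm1 tau y1 <= rho / 2) (y2rho : norm1 tau y2 <= rho / 2).

Definition summable_poly P := forall i, summable2 rho (val P`_i).

Let subst0 : subst_series y1 y2 (val (0 : cseries2 K)) = 0.
Proof. by rewrite val2_0 (@subst_series0 _ Kcomplete y1 y2 rho tau). Qed.

Lemma summable_polyM P Q : summable_poly P -> summable_poly Q -> summable_poly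
  (P * Q).
Proof.
move=> gP gQ i; rewrite coefM val2_sum; apply: summable2_sum => // k _.
by rewrite val2M; exact: summable2M.
Qed.

Lemma summable_poly1 : summable_poly 1.
Proof.
move=> i; rewrite coef1; case: (i == 0)%N; rewrite ?val2_1 ?val2_0.
  exact: summable2_1.
exact: summable2_0.
Qed.

Lemma summable_XsubC (a : cseries2 K) : summable2 rho (val a) ->
  summable_poly ('X - a%:P).
Proof.
move=> ga i; rewrite coefB coefX coefC val2B; apply: summable2D => //.
  case: (i == 1)%N; rewrite ?val2_1 ?val2_0; first exact: summable2_1.
  exact: summable2_0.
apply: summable2N; case: (i == 0)%N; rewrite ?val2_0//.
exact: summable2_0.
Qed.

Lemma eval_polyM P Q : summable_poly P -> summable_poly Q ->
  eval_poly (P * Q) = eval_poly P * eval_poly Q.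
Proof.
move=> gP gQ; rewrite /eval_poly -hornerM; congr horner.
apply/polyP => i; rewrite coef_map_id0// !coefM val2_sum.
rewrite (@subst_series_sum _ Kcomplete y1 y2 rho tau)//; last first.
  by move=> k; rewrite val2M; exact: summable2M.
apply: eq_bigr => k _; rewrite !coef_map_id0// val2M.
exact: (@subst_seriesM _ Kcomplete y1 y2 rho tau).
Qed.

Lemma eval_poly1 : eval_poly 1 = 1.
Proof.
have s1 : subst_series y1 y2 (val (1 : cseries2 K)) = 1.
  by rewrite val2_1 (@subst_series1 _ Kcomplete y1 y2 rho tau).
rewrite /eval_poly.
have -> : map_poly (fun a : cseries2 K => subst_series y1 y2 (val a)) 1 = 1.
  by apply/polyP => i; rewrite coef_map_id0// !coef1; case: (i == 0)%N.
by rewrite hornerC.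
Qed.

Lemma eval_XsubC (a : cseries2 K) : summable2 rho (val a) ->
  eval_poly ('X - a%:P) = poly_series zs - subst_series y1 y2 (val a).
Proof.
move=> ga; have s1 : subst_series y1 y2 (val (1 : cseries2 K)) = 1.
  by rewrite val2_1 (@subst_series1 _ Kcomplete y1 y2 rho tau).
rewrite /eval_poly.
have -> : map_poly (fun a : cseries2 K => subst_series y1 y2 (val a)) ('X - a%:P) =
    'X - (subst_series y1 y2 (val a))%:P.
  apply/polyP => i; rewrite coef_map_id0// !coefB !coefX !coefC.
  case: i => [|[|i]] /=; rewrite ?subr0 ?sub0r//.
  exact: (@subst_seriesN _ Kcomplete y1 y2 rho tau).
by rewrite hornerXsubC.
Qed.

Lemma summable_prod (I : Type) (r : seq I) (P : I -> {poly cseries2 K}) :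
  (forall i, summable_poly (P i)) -> summable_poly (\prod_(i <- r) P i).
Proof.
move=> gP; elim/big_ind: _ => //; [exact: summable_poly1|exact: summable_polyM].
Qed.

Lemma eval_prod (I : Type) (r : seq I) (P : I -> {poly cseries2 K}) :
  (forall i, summable_poly (P i)) ->
  eval_poly (\prod_(i <- r) P i) = \prod_(i <- r) eval_poly (P i).
Proof.
move=> gP; elim: r => [|i r IH]; first by rewrite !big_nil eval_poly1.
by rewrite !big_cons eval_polyM ?IH//; exact: summable_prod.
Qed.

Lemma eval_exp P k : summable_poly P -> eval_poly (P ^+ k) = eval_poly P ^+ k.
Proof.
move=> gP; elim: k => [|k IH]; first by rewrite !expr0 eval_poly1.
rewrite !exprS eval_polyM ?IH//.
by elim: k {IH} => [|k IH]; rewrite ?expr0 ?exprS;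
  [exact: summable_poly1|exact: summable_polyM].
Qed.

Lemma eval_poly_lim W P q : (size P <= W)%N -> summable_poly P ->
  geom_lim (fun N => (\sum_(i < W) subst2 y1 y2 (trunc2 N (val P`_i)) * zs ^+ i)`_q)
    (coef2 (eval_poly P) q 0).
Proof.
move=> PW gP; rewrite /eval_poly (horner_coef_wide (n := W)); last first.
  by rewrite (leq_trans (size_poly _ _)).
have -> : coef2 (\sum_(i < W)
     (map_poly (fun a : cseries2 K => subst_series y1 y2 (val a)) P)`_i *
     poly_series zs ^+ i) q 0 =
   \sum_(i < W) \sum_(k < q.+1) subst_coef y1 y2 (val P`_i) k * (zs ^+ i)`_(q - k).
  rewrite (big_morph (fun a => coef2 a q 0) (id1 := 0) (op1 := +%R))//.
  apply: eq_bigr => i _; rewrite coef_map_id0// -poly_seriesX /=.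
  by apply: eq_bigr => k _; rewrite big_ord1 /=.
apply: (@geom_lim_ext _ (fun N => \sum_(i < W) \sum_(k < q.+1)
   (subst2 y1 y2 (trunc2 N (val P`_i)))`_k * (zs ^+ i)`_(q - k))) => [N|].
  by rewrite coef_sum; apply: eq_bigr => i _; rewrite coefM.
apply: geom_lim_sum => i; apply: geom_lim_sum => k.
by apply: geom_limM; [exact: (@subst_coefP _ Kcomplete _ _ rho tau)|exact:
  geom_lim_cst].
Qed.

End EvalPoly.

(** * Congruences and the base change t = s^n *)

Section Congruence.
Variable K : comNzRingType.
Implicit Types p q : {poly K}.

Definition eq_upto L p q := forall i, (i < L)%N -> p`_i = q`_i.

Lemma eq_uptoM L p q p' q' : eq_upto L p p' -> eq_upto L q q' ->
  eq_upto L (p * q) (p' * q').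
Proof.
move=> pp' qq' i iL; rewrite !coefM; apply: eq_bigr => k _.
by rewrite pp' ?qq'//; apply: leq_ltn_trans iL; rewrite ?leq_subr// -ltnS.
Qed.

Lemma eq_uptoX L p p' k : eq_upto L p p' -> eq_upto L (p ^+ k) (p' ^+ k).
Proof.
by move=> pp'; elim: k => [|k IH]; rewrite ?expr0// !exprS; exact: eq_uptoM.
Qed.

Lemma eq_upto_sum L (I : Type) (r : seq I) (p q : I -> {poly K}) :
  (forall i, eq_upto L (p i) (q i)) ->
  eq_upto L (\sum_(i <- r) p i) (\sum_(i <- r) q i).
Proof. by move=> pq k kL; rewrite !coef_sum; apply: eq_bigr => i _; exact: pq. Qed.

Lemma eq_uptoZ L c p q : eq_upto L p q -> eq_upto L (c *: p) (c *: q).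
Proof. by move=> pq i iL; rewrite !coefZ pq. Qed.

End Congruence.

Lemma sum_dvdn (V : nmodType) (n N : nat) (F : nat -> V) : (0 < n)%N ->
  \sum_(i < N * n) (if (n %| i)%N then F i else 0) = \sum_(i < N) F (i * n)%N.
Proof.
case: n => // n _; elim: N => [|N IH]; first by rewrite mul0n !big_ord0.
rewrite [RHS]big_ord_recr /= -IH mulSn addnC.
rewrite big_split_ord /=; congr (_ + _).
rewrite big_ord_recl /= addn0 dvdn_mull// big1 ?addr0// => i _.
rewrite dvdn_addr ?dvdn_mull// /bump /= add1n gtnNdvd//.
by rewrite ltnS.
Qed.

Section RamifiedEval.
Variables (K : numFieldType) (Kcomplete : geom_complete K).
Variables (n : nat) (n0 : (0 < n)%N) (L : nat).
Variables (x1 x2 z y1 y2 : {poly K}).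
Hypotheses (y1x1 : eq_upto L (y1 ^+ n) (x1 \Po 'X^n)).
Hypotheses (y2x2 : eq_upto L (y2 ^+ n) (x2 \Po 'X^n)).
Variables (rho tau : K).
Hypotheses (rho0 : 0 < rho) (tau0 : 0 < tau).
Hypotheses (y1rho : norm1 tau y1 <= rho / 2) (y2rho : norm1 tau y2 <= rho / 2).

Lemma ramify0 : ramify n 0 = 0 :> cseries2 K.
Proof. by apply: val_inj; apply: series2P => i j /=; rewrite if_same. Qed.

(** Below [N * n] the exponents of the ramified series are the i n with i < N, so the two
    truncations correspond exactly; then y_k^n is replaced by x_k(s^n) modulo s^L. *)
Lemma subst2_ramify N (a : cseries2 K) :
  eq_upto L (subst2 y1 y2 (trunc2 (N * n) (val (ramify n a))))
            (subst2 x1 x2 (trunc2 N (val a)) \Po 'X^n).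
Proof.
rewrite !subst2_trunc /=.
have -> : \sum_(i < N * n) \sum_(j < N * n)
      (if (n %| i)%N && (n %| j)%N then coef2 a (i %/ n) (j %/ n) else 0) *:
      (y1 ^+ i * y2 ^+ j) =
    \sum_(i < N) \sum_(j < N) coef2 a i j *: ((y1 ^+ n) ^+ i * (y2 ^+ n) ^+ j).
  transitivity (\sum_(i < N * n) if (n %| i)%N then
      \sum_(j < N) coef2 a (i %/ n) j *: (y1 ^+ i * (y2 ^+ n) ^+ j) else 0).
    apply: eq_bigr => i _; case: ifP => ni; last first.
      by rewrite big1// => j _; rewrite scale0r.
    transitivity (\sum_(j < N * n) if (n %| j)%N then
        coef2 a (i %/ n) (j %/ n) *: (y1 ^+ i * y2 ^+ j) else 0).
      by apply: eq_bigr => j _ /=; case: ifP => //; rewrite scale0r.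
    rewrite (sum_dvdn N (fun j => coef2 a (i %/ n) (j %/ n) *:
      (y1 ^+ i * y2 ^+ j)) n0).
    by apply: eq_bigr => j _; rewrite mulnK// (mulnC j) exprM.
  rewrite (sum_dvdn N (fun i => \sum_(j < N) coef2 a (i %/ n) j *:
    (y1 ^+ i * (y2 ^+ n) ^+ j)) n0).
  by apply: eq_bigr => i _; apply: eq_bigr => j _; rewrite mulnK// (mulnC i) exprM.
rewrite (raddf_sum (comp_poly 'X^n)); apply: eq_upto_sum => i.
rewrite (raddf_sum (comp_poly 'X^n)); apply: eq_upto_sum => j.
rewrite /= comp_polyZ comp_polyM !rmorphXn /=; apply: eq_uptoZ.
by apply: eq_uptoM; exact: eq_uptoX.
Qed.

Definition base_eval (f : {poly cseries2 K}) N :=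
  \sum_(i < size f) subst2 x1 x2 (trunc2 N (val f`_i)) * z ^+ i.

Lemma base_evalE (f : {poly cseries2 K}) N :
  base_eval f N = \sum_(i < size f) \sum_(k < N) \sum_(l < N)
    coef2 f`_i k l *: (x1 ^+ k * x2 ^+ l * z ^+ i).
Proof.
apply: eq_bigr => i _; rewrite subst2_trunc mulr_suml.
apply: eq_bigr => k _; rewrite mulr_suml; apply: eq_bigr => l _.
by rewrite -scalerAl.
Qed.

Variable f : {poly cseries2 K}.
Hypothesis gf : summable_poly rho (map_poly (ramify n) f).

Lemma ramified_eval_lim q : (q < L)%N ->
  geom_lim (fun N => (base_eval f N \Po 'X^n)`_q)
    (coef2 (eval_poly y1 y2 (z \Po 'X^n) (map_poly (ramify n) f)) q 0).
Proof.
move=> qL; have sz : (size (map_poly (ramify n) f) <= size f)%N by exact: size_poly.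
have /(geom_lim_sub (phi := fun N => (N * n)%N)) :=
  @eval_poly_lim _ Kcomplete y1 y2 (z \Po 'X^n) rho tau rho0 tau0 y1rho y2rho _
    _ q sz gf.
move=> /(_ (fun N => leq_pmulr N n0)); apply: geom_lim_ext => N.
rewrite /base_eval raddf_sum; move: q qL; apply: eq_upto_sum => i.
rewrite /= comp_polyM rmorphXn /=; apply: eq_uptoM => //.
rewrite coef_map_id0 ?ramify0//; exact: subst2_ramify.
Qed.

Lemma ramified_eval_coef q : (q * n < L)%N ->
  geom_lim (fun N => (base_eval f N)`_q)
    (coef2 (eval_poly y1 y2 (z \Po 'X^n) (map_poly (ramify n) f)) (q * n) 0).
Proof.
move=> /ramified_eval_lim; apply: geom_lim_ext => N.
by rewrite coef_comp_poly_Xn// dvdn_mull// mulnK.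
Qed.

(** Modulo s^L the partial sums are polynomials in s^n. From order L on this may fail, since y_k is
    only an approximate root. *)
Lemma ramified_eval_ndvd q : (q < L)%N -> ~~ (n %| q)%N ->
  coef2 (eval_poly y1 y2 (z \Po 'X^n) (map_poly (ramify n) f)) q 0 = 0.
Proof.
move=> /ramified_eval_lim ul nq; apply: (geom_lim_unique Kcomplete ul).
apply: geom_lim_ext (geom_lim_cst 0) => N.
by rewrite coef_comp_poly_Xn// (negbTE nq).
Qed.

End RamifiedEval.

(** * Orders of power series in one variable *)

Section NthRoot.
Variable K : numClosedFieldType.
Implicit Types u v x y : {poly K}.

Lemma coef0_exp (A : comNzRingType) (p : {poly A}) n : (p ^+ n)`_0 = p`_0 ^+ n.
Proof. by rewrite -!horner_coef0 horner_exp. Qed.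

Lemma exprD_linear (A : comNzRingType) (v w : A) n :
  exists r, (v + w) ^+ n.+1 = v ^+ n.+1 + w * (n.+1%:R * v ^+ n) + w * w * r.
Proof.
elim: n => [|n [r IH]]; first by exists 0; rewrite !expr1 expr0; ring.
exists (r * (v + w) + n.+1%:R * v ^+ n).
by rewrite exprSr IH -(natr1 n.+1) !exprS; ring.
Qed.

Lemma nth_root_poly n u L : (0 < n)%N -> u`_0 != 0 ->
  exists v, eq_upto L.+1 (v ^+ n) u.
Proof.
case: n => // n _ u0; elim: L => [|L [v vu]].
  exists (n.+1.-root u`_0)%:P => -[|i]//= _.
  by rewrite coef0_exp coefC /= rootCK.
have v0 : v`_0 != 0.
  apply: contraNneq u0 => v0.
  by rewrite -(vu 0%N)// coef0_exp v0 expr0n.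
have d0 : n.+1%:R * v`_0 ^+ n != 0 by rewrite mulf_neq0 ?pnatr_eq0 ?expf_neq0.
(* A Newton step: [c] cancels the error at X^(L+1). The derivative of the power is invertible at 0,
   and the quadratic remainder has order at least 2(L+1). *)
pose c := (u - v ^+ n.+1)`_(L.+1) / (n.+1%:R * v`_0 ^+ n).
set w := c *: 'X^(L.+1).
have wq q i : (w * q)`_i = if (i < L.+1)%N then 0 else c * q`_(i - L.+1).
  by rewrite -scalerAl coefZ coefXnM; case: ifP; rewrite ?mulr0.
have [r vr] := exprD_linear v w n.
exists (v + w) => i; rewrite ltnS leq_eqVlt vr 2!coefD -mulrA !wq => /orP[/eqP
  ->|iL].
  rewrite ltnn subnn /= mulr0 addr0.
  by rewrite -polyC_natr coefCM coef0_exp divfK// coefB addrC subrK.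
by rewrite iL !addr0; exact: vu.
Qed.

(** With x = X^w u and u(0) nonzero, it suffices to extract a root of u(X^n) and multiply it by X^w.
    The constant term is recorded because it controls the norm of [y]. *)
Lemma nth_root_order n x w L : (0 < n)%N -> t_order x w ->
  exists y, [/\ eq_upto L.+1 (y ^+ n) (x \Po 'X^n), 'X^w %| y
              & y`_0 ^+ n = x`_0].
Proof.
move=> n0 [xw xlt].
have [u xu] : exists u, x = u * 'X^w.
  exists (\poly_(i < size x) x`_(i + w)); apply/polyP => i; rewrite coefMXn.
  case: ltnP => [/xlt ->//|wi]; rewrite coef_poly subnK//.
  by case: ltnP => // h; rewrite nth_default// (leq_trans h)// leq_subr.
have u0 : (u \Po 'X^n)`_0 != 0.
  rewrite coef_comp_poly_Xn// dvdn0 div0n.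
  by apply/eqP; move: xw; rewrite xu coefMXn ltnn subnn.
have [v vu] := nth_root_poly L n0 u0.
have yx : eq_upto L.+1 ((v * 'X^w) ^+ n) (x \Po 'X^n).
  rewrite xu comp_polyM rmorphXn /= comp_polyX exprMn -!exprM mulnC.
  by apply: eq_uptoM.
exists (v * 'X^w); split=> //; first exact: dvdp_mull.
by rewrite -coef0_exp yx// coef_comp_poly_Xn// dvdn0 div0n.
Qed.

End NthRoot.

Section SmallRadius.
Variable K : numFieldType.

Lemma norm1_le_coef0 (tau : K) (y : {poly K}) : 0 <= tau -> tau <= 1 ->
  norm1 tau y <= `|y`_0| + tau * \sum_(i < size y) `|y`_i|.
Proof.
move=> t0 t1; rewrite /norm1 (poly_norm_wide _ (seminorm_norm K) (leqnSn (size y))).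
rewrite big_ord_recl /= expr0 mulr1 lerD2l.
apply: (@le_trans _ _ (tau * \sum_(i < size y) `|y`_i.+1|)).
  rewrite mulr_sumr; apply: ler_sum => i _; rewrite /bump /= add1n mulrC.
  by rewrite ler_wpM2r// exprS ler_piMr// exprn_ile1.
rewrite ler_wpM2l//; case sz: (size y) => [|k]; first by rewrite !big_ord0.
rewrite big_ord_recr big_ord_recl /= nth_default ?sz// normr0 addr0.
by rewrite lerDr.
Qed.

Lemma norm1_small (rho : K) (y1 y2 : {poly K}) : 0 < rho ->
  `|y1`_0| <= rho / 4 -> `|y2`_0| <= rho / 4 ->
  exists tau, [/\ 0 < tau, norm1 tau y1 <= rho / 2 & norm1 tau y2 <= rho / 2].
Proof.
move=> r0 y1r y2r; pose s (y : {poly K}) := \sum_(i < size y) `|y`_i|.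
have s0 y : 0 <= s y by exact: sumr_ge0.
have r40 : 0 < rho / 4 by rewrite divr_gt0.
have d0 : 0 < rho / 4 + (s y1 + s y2) by rewrite ltr_pwDl// addr_ge0.
have e2 : rho / 2 = rho / 4 + rho / 4 by field.
have t0 : 0 < rho / 4 / (rho / 4 + (s y1 + s y2)) by rewrite divr_gt0.
have t1 : rho / 4 / (rho / 4 + (s y1 + s y2)) <= 1.
  by rewrite ler_pdivrMr// mul1r lerDl addr_ge0.
(* Half of the allowed [rho / 2] is spent on the constant terms, and this tau keeps the rest below
   the other half. The summand [rho / 4] of the denominator makes tau well defined and at most 1. *)
exists (rho / 4 / (rho / 4 + (s y1 + s y2))); split=> //; rewrite e2.
  apply: le_trans (norm1_le_coef0 _ (ltW t0) t1) _; apply: lerD => //.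
  rewrite mulrAC ler_pdivrMr// ler_pM2l//.
  by rewrite addrCA lerDl addr_ge0// ltW.
apply: le_trans (norm1_le_coef0 _ (ltW t0) t1) _; apply: lerD => //.
rewrite mulrAC ler_pdivrMr// ler_pM2l//.
by rewrite addrA lerDr addr_ge0// ltW.
Qed.

End SmallRadius.

Section Order.
Variable K : numFieldType.
Implicit Types a b : series2 K.

Definition vexact a h := vge a h /\ coef2 a h 0 != 0.

Lemma coef2M0 a b q :
  coef2 (a * b) q 0 = \sum_(k < q.+1) coef2 a k 0 * coef2 b (q - k) 0.
Proof. by apply: eq_bigr => k _; rewrite big_ord1. Qed.

Lemma vge_le a h k : (k <= h)%N -> vge a h -> vge a k.
Proof. by move=> kh ah q qk; apply: ah; exact: leq_trans qk kh. Qed.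

Lemma vgeD a b h : vge a h -> vge b h -> vge (a + b) h.
Proof. by move=> ah bh q qh /=; rewrite ah// bh// addr0. Qed.

Lemma vgeN a h : vge a h -> vge (- a) h.
Proof. by move=> ah q qh /=; rewrite ah// oppr0. Qed.

Lemma vgeM a b h k : vge a h -> vge b k -> vge (a * b) (h + k).
Proof.
move=> ah bk q qhk; rewrite coef2M0 big1// => i _.
have [/ah ->|hi] := ltnP i h; first by rewrite mul0r.
rewrite (bk (q - i)%N) ?mulr0// ltn_subLR; last by rewrite -ltnS.
by rewrite (leq_trans qhk)// leq_add2r.
Qed.

Lemma vge_prod (I : Type) (r : seq I) (A : I -> series2 K) (h : I -> nat) :
  (forall i, vge (A i) (h i)) -> vge (\prod_(i <- r) A i) (\sum_(i <- r) h i).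
Proof.
move=> Ah; elim: r => [|i r IH]; first by rewrite !big_nil.
by rewrite !big_cons; exact: vgeM.
Qed.

Lemma vexactM a b h k : vexact a h -> vexact b k -> vexact (a * b) (h + k).
Proof.
move=> [ah ah0] [bk bk0]; split; first exact: vgeM.
have hlt : (h < (h + k).+1)%N by rewrite ltnS leq_addr.
rewrite coef2M0 (bigD1 (Ordinal hlt))//= addKn big1 ?addr0 ?mulf_neq0//.
move=> i ih; have [/ah ->|hi] := ltnP i h; first by rewrite mul0r.
rewrite (bk (h + k - i)%N) ?mulr0//; have := ltn_ord i; rewrite ltnS => ihk.
rewrite ltn_subLR// ltn_add2r ltn_neqAle hi andbT.
by apply: contra ih => /eqP hi'; apply/eqP/val_inj.
Qed.

Lemma vexact1 : vexact 1 0.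
Proof. by split=> //=; rewrite oner_eq0. Qed.

Lemma vexact_prod (I : Type) (r : seq I) (A : I -> series2 K) (h : I -> nat) :
  (forall i, vexact (A i) (h i)) -> vexact (\prod_(i <- r) A i) (\sum_(i <- r) h i).
Proof.
move=> Ah; elim: r => [|i r IH]; first by rewrite !big_nil; exact: vexact1.
by rewrite !big_cons; exact: vexactM.
Qed.

Lemma vexactX a h k : vexact a h -> vexact (a ^+ k) (k * h).
Proof.
move=> ah; elim: k => [|k IH]; first by rewrite mul0n expr0; exact: vexact1.
by rewrite exprS mulSn; exact: vexactM.
Qed.

Lemma vgeX a h k : vge a h -> vge (a ^+ k) (k * h).
Proof.
move=> ah; elim: k => [|k IH]; first by [].
by rewrite exprS mulSn; exact: vgeM.
Qed.

Lemma vexact_vge a h k : vexact a h -> vge a k <-> (k <= h)%N.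
Proof.
move=> [ah ah0]; split=> [ak|/vge_le]; last exact.
by rewrite leqNgt; apply: contra ah0 => /ak ->.
Qed.

Lemma vexact_unique a h k : vexact a h -> vexact a k -> h = k.
Proof.
move=> ah ak; apply/eqP; rewrite eqn_leq.
by apply/andP; split; [apply/(vexact_vge _ ak)|apply/(vexact_vge _ ah)];
  [case: ah|case: ak].
Qed.

Lemma vexact_add a b h : vexact a h -> vge b h.+1 -> vexact (a + b) h.
Proof.
move=> [ah ah0] bh; split; first by apply: vgeD => //; exact: vge_le bh.
by rewrite /= bh// addr0.
Qed.

(** The dichotomy is cut off at [h] because the zero series has no exact order. *)
Lemma vge_or_vexact a h : vge a h \/ exists2 k, (k < h)%N & vexact a k.
Proof.
elim: h => [|h [ah|[k kh ak]]]; first by left.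
  have [a0|a0] := eqVneq (coef2 a h 0) 0; last by right; exists h.
  by left=> q; rewrite ltnS leq_eqVlt => /orP[/eqP ->//|/ah].
by right; exists k => //; exact: ltnW.
Qed.

(** If some [A i0] has order at least [mu], then by the ultrametric inequality
    [F] and [G] both have large order; otherwise [A i] and [B i] have the same
    order for all [i]. *)
Lemma compare_orders (I : finType) (A B : I -> series2 K) (F G : series2 K)
    (w : I -> I -> nat) (n e mu m : nat) :
  (0 < n)%N -> (0 < e)%N ->
  \prod_i A i = F ^+ (n * e) -> \prod_i B i = G ^+ n ->
  (forall i, vge (B i - A i) mu) ->
  (forall i0, vge (A i0) mu -> forall i, vge (A i) (w i0 i)) ->
  (forall i0 i, (w i0 i <= mu)%N) ->
  (forall i0, (n * n * m < \sum_i w i0 i)%N) ->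
  (vge G (n * m).+1 /\ forall k, (e * k <= n * m)%N -> vge F k.+1) \/
  exists k, vexact F k /\ vexact G (e * k).
Proof.
move=> n0 e0 FA GB AB Aw wmu wm.
have [[i0 Ai0]|noA] := pselect (exists i0, vge (A i0) mu).
  (* [A] and [F] stand for zeta_j and F_j, [B] and [G] for zeta and f. Both powers have order above
     n n m, and dividing by the exponents gives the two bounds. *)
  left; have vF : vge (F ^+ (n * e)) (n * n * m).+1.
    by rewrite -FA; apply: vge_le (wm i0) _; apply: vge_prod; exact: Aw.
  have vG : vge (G ^+ n) (n * n * m).+1.
    rewrite -GB; apply: vge_le (wm i0) _; apply: vge_prod => i.
    rewrite -[B i](subrK (A i)); apply: vgeD; last exact: Aw.
    exact: vge_le (AB i).
  split.
    have [//|[k km Gk]] := vge_or_vexact G (n * m).+1.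
    have /(vexact_vge _ (@vexactX G _ n Gk)) := vG.
    by rewrite -mulnA ltn_pmul2l// ltnNge -ltnS km.
  move=> k ekm; have [//|[h hk Fh]] := vge_or_vexact F k.+1.
  have /(vexact_vge _ (@vexactX F _ (n * e) Fh)) := vF.
  rewrite -!mulnA ltn_pmul2l// ltnNge (leq_trans _ ekm)//.
  by rewrite leq_mul2l -ltnS hk orbT.
right.
have /choice[h hP] : forall i, exists h, (h < mu)%N /\ vexact (A i) h.
  move=> i; have [Ai|[k kmu Ak]] := vge_or_vexact (A i) mu; last by exists k.
  by case: noA; exists i.
have FS : vexact (F ^+ (n * e)) (\sum_i h i).
  by rewrite -FA; apply: vexact_prod => i; case: (hP i).
have GS : vexact (G ^+ n) (\sum_i h i).
  rewrite -GB; apply: vexact_prod => i; have [hmu Ai] := hP i.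
  rewrite -[B i](subrK (A i)) addrC; apply: vexact_add => //.
  exact: vge_le (AB i).
(* A power of exact order forces an exact order on its base: a base of larger order than the power
   would, as r > 0, make the order of the power too large. *)
have root a r : (0 < r)%N -> vexact (a ^+ r) (\sum_i h i) ->
    exists2 k, vexact a k & (r * k = \sum_i h i)%N.
  move=> r0 aS; have [av|[k _ ak]] := vge_or_vexact a (\sum_i h i).+1.
    have /(vexact_vge _ aS) := @vgeX a _ r av.
    by rewrite leqNgt leq_pmull.
  by exists k => //; exact: vexact_unique (@vexactX a _ r ak) aS.
have ne0 : (0 < n * e)%N by rewrite muln_gt0 n0.
have [k Fk kS] := root F (n * e)%N ne0 FS.
have [k' Gk' k'S] := root G n n0 GS.
exists k; split => //; suff <- : k' = (e * k)%N by [].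
by apply/eqP; rewrite -(eqn_pmul2l n0) k'S mulnA kS.
Qed.

End Order.

(** * Conjugates and minimal polynomials *)

(** [X^n - 1] is separable, so it has n distinct roots, and n distinct n-th roots of unity in a
    field include a primitive one. *)
Lemma prim_root_exists (F : closedFieldType) n : n%:R != 0 :> F ->
  exists w : F, n.-primitive_root w.
Proof.
move=> nF; have n0 : (0 < n)%N by case: n nF => //; rewrite eqxx.
have [rs rsE] := closed_field_poly_normal ('X^n - 1 : {poly F}).
have m1 : 'X^n - 1 \is @monic F by rewrite -(prednK n0) -polyC1 monicXnsubC.
rewrite (monicP m1) scale1r in rsE.
have srs : size rs = n.
  by apply/succn_inj; rewrite -(size_prod_XsubC _ id) -rsE -polyC1 size_XnsubC.
have /hasP[w _ wn] : has n.-primitive_root rs; last by exists w.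
apply: cyclic.has_prim_root; rewrite ?srs//.
  apply/allP => x xrs; rewrite unity_rootE -subr_eq0.
  have : root ('X^n - 1) x by rewrite rsE root_prod_XsubC.
  by rewrite rootE !hornerE.
by rewrite -separable.separable_prod_XsubC -rsE;
  exact: cyclotomic.separable_Xn_sub_1.
Qed.

Section Domain.
Variable K : numFieldType.

(** The lexicographically lowest monomials multiply without cancellation. This is what bounds the
    number of roots of a monic polynomial. *)
Lemma cseries2_domain (a b : cseries2 K) : a * b = 0 -> a = 0 \/ b = 0.
Proof.
suff lead (c : cseries2 K) : c <> 0 -> exists i j, [/\ coef2 c i j != 0,
    forall k l, (k < i)%N -> coef2 c k l = 0 & forall l, (l < j)%N -> coef2 c i
      l = 0].
  move=> ab; have [|a0] := pselect (a = 0); first by left.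
  have [|b0] := pselect (b = 0); first by right.
  have [i [j [aij ai aj]]] := lead a a0; have [k [l [bkl bk bl]]] := lead b b0.
  have := congr1 (fun c : cseries2 K => coef2 c (i + k) (j + l)) ab.
  have ilt : (i < (i + k).+1)%N by rewrite ltnS leq_addr.
  have jlt : (j < (j + l).+1)%N by rewrite ltnS leq_addr.
  rewrite /= (bigD1 (Ordinal ilt))//= (bigD1 (Ordinal jlt))//= !addKn.
  rewrite big1 => [|l' jl']; last first.
    have [/aj ->|jl] := ltnP l' j; first by rewrite mul0r.
    rewrite (bl (j + l - l')%N) ?mulr0// ltn_subLR; last by rewrite -ltnS.
    rewrite ltn_add2r ltn_neqAle jl andbT.
    by apply: contra jl' => /eqP h; apply/eqP/val_inj.
  rewrite big1 => [|i' ii']; last first.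
    apply: big1 => l' _; have [/ai ->|ii] := ltnP i' i; first by rewrite mul0r.
    rewrite (bk (i + k - i')%N) ?mulr0// ltn_subLR; last by rewrite -ltnS.
    rewrite ltn_add2r ltn_neqAle ii andbT.
    by apply: contra ii' => /eqP h; apply/eqP/val_inj.
  by rewrite !addr0 => /eqP; rewrite mulf_eq0 (negbTE aij) (negbTE bkl).
move=> c0; have ex : exists i, `[< exists j, coef2 c i j != 0 >].
  apply: contrapT => noc; apply: c0; apply: val_inj; apply: series2P => i j /=.
  by apply/eqP; apply: contrapT => /negP cij; apply: noc; exists i;
    apply/asboolP; exists j.
case: (ex_minnP ex) => i /asboolP exj imin; case: (ex_minnP exj) => j cij jmin.
exists i, j; split=> // [k l ki|l lj].
  apply/eqP; apply: contraTT ki => ckl; rewrite -leqNgt; apply: imin.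
  by apply/asboolP; exists l.
by apply/eqP; apply: contraTT lj => cl; rewrite -leqNgt; exact: jmin.
Qed.

End Domain.

Lemma size_roots_monic (A : comNzRingType) (p : {poly A}) (rs : seq A) :
  (forall a b : A, a * b = 0 -> a = 0 \/ b = 0) -> p \is monic ->
  uniq rs -> all (root p) rs -> (size rs < size p)%N.
Proof.
move=> domA; elim: rs p => [|r rs IH] p pm /=.
  by rewrite size_poly_gt0 monic_neq0.
move=> /andP[rrs urs] /andP[/factor_theorem[q pq] prs].
have qm : q \is monic by rewrite -(monicMr _ (monicXsubC r)) -pq.
rewrite pq size_Mmonic ?monicXsubC ?monic_neq0// size_XsubC addn2 /= ltnS.
apply: IH => //; apply/allP => s srs.
have := allP prs _ srs; rewrite pq !rootE hornerM hornerXsubC => /eqP /domA[/eqP//|].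
by move/eqP; rewrite subr_eq0 => /eqP sr; move: rrs; rewrite -sr srs.
Qed.

Section Ramify.
Variables (K : numFieldType) (n' : nat).
Local Notation n := n'.+1.
Implicit Types a b : cseries2 K.

Lemma ramify_is_additive : additive (@ramify K n).
Proof.
move=> a b; apply: val_inj; apply: series2P => i j /=.
by case: ifP => // _; rewrite subrr.
Qed.

Lemma ramify_is_multiplicative : multiplicative (@ramify K n).
Proof.
split=> [a b|]; apply: val_inj; apply: series2P => i j /=; last first.
  case: ifP => [/andP[/dvdnP[k ->] /dvdnP[l ->]]|].
    by rewrite !mulnK// !muln_eq0 !orbF.
  by case: i => [|i]; case: j => [|j]; rewrite ?dvdn0 ?andbF.
have [/andP[ni nj]|nij] := boolP ((n %| i) && (n %| j))%N; last first.
  rewrite big1// => k _; rewrite big1// => l _.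
  case: ifP => [/andP[nk nl]|_]; last by rewrite mul0r.
  case: ifP => [/andP[nik njl]|_]; last by rewrite mulr0.
  have ni : (n %| i)%N by rewrite -(subnK (leq_ord k)) dvdn_add.
  have nj : (n %| j)%N by rewrite -(subnK (leq_ord l)) dvdn_add.
  by rewrite ni nj in nij.
case/dvdnP: ni => i' ->; case/dvdnP: nj => j' ->; rewrite !mulnK//.
pose F k l := coef2 a k l * coef2 b (i' - k) (j' - l).
transitivity (\sum_(k < i'.+1 * n) if (n %| k)%N then \sum_(l < j'.+1 * n)
    if (n %| l)%N then F (k %/ n)%N (l %/ n)%N else 0 else 0).
  rewrite (sum_dvdn i'.+1 (fun k => \sum_(l < j'.+1 * n)
    if (n %| l)%N then F (k %/ n)%N (l %/ n)%N else 0))//.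
  apply: eq_bigr => k _; rewrite (sum_dvdn j'.+1 (fun l => F (k * n %/ n)%N (l
    %/ n)%N))//.
  by apply: eq_bigr => l _; rewrite !mulnK.
(* There is no multiple of n strictly between m n and (m + 1) n, so both ranges give the same
   sum. *)
have widen (V : nmodType) m (G : nat -> V) :
    \sum_(k < m.+1 * n) (if (n %| k)%N then G k else 0) =
    \sum_(k < (m * n).+1) (if (n %| k)%N then G k else 0).
  rewrite [RHS](big_ord_widen (m.+1 * n) (fun k => if (n %| k)%N then G k else 0));
    last by rewrite mulSn addSn ltnS leq_addl.
  rewrite [RHS]big_mkcond; apply: eq_bigr => k _ /=.
  case: ltnP => // mk; case: ifP => // /dvdnP[k1 kE].
  have := ltn_ord k; rewrite kE ltn_pmul2r// ltnS leqNgt.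
  by rewrite kE ltn_pmul2r// in mk; rewrite mk.
apply: etrans (widen _ i' (fun k => \sum_(l < j'.+1 * n)
    if (n %| l)%N then F (k %/ n)%N (l %/ n)%N else 0)) _.
apply: eq_bigr => k _.
case: ifP => nk; last first.
  by rewrite big1// => l _; rewrite /= mul0r.
apply: etrans (widen _ j' (fun l => F (k %/ n)%N (l %/ n)%N)) _.
apply: eq_bigr => l _ /=; case: ifP => nl; last by rewrite mul0r.
rewrite !dvdn_sub ?dvdn_mull//= /F.
case/dvdnP: nk => k' ->; case/dvdnP: nl => l' ->.
by rewrite -!mulnBl !mulnK.
Qed.

HB.instance Definition _ := GRing.isAdditive.Build
  (cseries2 K) (cseries2 K) (@ramify K n) ramify_is_additive.
HB.instance Definition _ := GRing.isMultiplicative.Build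
  (cseries2 K) (cseries2 K) (@ramify K n) ramify_is_multiplicative.

Lemma ramify_inj : injective (@ramify K n).
Proof.
move=> a b ab; apply: val_inj; apply: series2P => i j.
have := congr1 (fun c : cseries2 K => coef2 c (i * n) (j * n)) ab.
by rewrite /= !dvdn_mull// !mulnK.
Qed.

End Ramify.

Lemma monic_size1 (A : nzRingType) (p : {poly A}) :
  p \is monic -> size p = 1%N -> p = 1.
Proof.
move=> pm sp; have p1 : p`_0 = 1 by move/monicP: pm; rewrite lead_coefE sp.
have pE : p = (p`_0)%:P by apply: size1_polyC; rewrite sp.
by apply: (etrans pE); rewrite p1; exact: polyC1.
Qed.

Lemma size_monic_exp (A : comNzRingType) (p : {poly A}) k : p \is monic ->
  size (p ^+ k) = ((size p).-1 * k).+1.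
Proof.
move=> pm; elim: k => [|k IH]; first by rewrite expr0 size_poly1 muln0.
rewrite exprS size_Mmonic ?monic_neq0// ?monic_exp// IH mulnS.
have : (0 < size p)%N by rewrite size_poly_gt0 monic_neq0.
by case: (size p) => // s _; rewrite addSn addnS.
Qed.

(** * The action of (Z/n)^2 and its orbits *)

Section Action.
Variables (K : numFieldType) (n' : nat) (w : K).
Local Notation n := n'.+1.
Hypothesis w_prim : n.-primitive_root w.
Implicit Types (a b : cseries2 K) (P : {poly cseries2 K}).

Lemma norm_prim_root : `|w| = 1.
Proof.
have wn : `|w| ^+ n = 1 by rewrite -normrX (prim_expr_order w_prim) normr1.
by apply/eqP; move/eqP: wn; rewrite pexpr_eq1.
Qed.

Lemma norm_twist (e : nat * nat) a i j :
  `|w ^+ (e.1 * i + e.2 * j) * coef2 a i j| = `|coef2 a i j|.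
Proof. by rewrite normrM normrX norm_prim_root expr1n mul1r. Qed.

Fact twist_subproof (e : nat * nat) a :
  convergent2 (Series2 (fun i j => w ^+ (e.1 * i + e.2 * j) * coef2 a i j)).
Proof.
apply: (@convergent2_dominated _ id id a) => //; last exact: cseries2_convergent.
by move=> i j; rewrite norm_twist.
Qed.

(** The substitution [y1 |-> w^(e.1) y1], [y2 |-> w^(e.2) y2]; these are the
    Galois conjugations of [K{x1^(1/n), x2^(1/n)}] over [K{x1, x2}]. *)
Definition twist (e : nat * nat) a : cseries2 K := cseries2_of (twist_subproof e a).

Lemma twist_is_additive e : additive (twist e).
Proof. by move=> a b; apply: val_inj; apply: series2P => i j /=; rewrite mulrBr. Qed.

Lemma twist_is_multiplicative e : multiplicative (twist e).
Proof.
split=> [a b|]; apply: val_inj; apply: series2P => i j /=.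
  rewrite mulr_sumr; apply: eq_bigr => k _; rewrite mulr_sumr.
  apply: eq_bigr => l _; rewrite mulrACA -exprD; congr (_ ^+ _ * _).
  by rewrite addnACA -!mulnDr !subnKC ?leq_ord.
by case: i => [|i]; case: j => [|j]; rewrite ?muln0 ?mulr0 ?mulr1 ?andbF ?mulr0.
Qed.

HB.instance Definition _ e := GRing.isAdditive.Build
  (cseries2 K) (cseries2 K) (twist e) (twist_is_additive e).
HB.instance Definition _ e := GRing.isMultiplicative.Build
  (cseries2 K) (cseries2 K) (twist e) (twist_is_multiplicative e).

Lemma twist_ramify e a : twist e (ramify n a) = ramify n a.
Proof.
apply: val_inj; apply: series2P => i j /=.
case: ifP => [/andP[ni nj]|]; last by rewrite mulr0.
have /eqP -> : w ^+ (e.1 * i + e.2 * j) == 1; last by rewrite mul1r.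
by rewrite -(prim_order_dvd w_prim) dvdn_add ?dvdn_mull.
Qed.

(** The generators (1, 0) and (0, 1) already force n to divide both exponents of every term. If [a]
    is bounded at radius r, the descended series is bounded at r^n. *)
Lemma twist_fixed a : (forall e, twist e a = a) -> exists b, ramify n b = a.
Proof.
move=> fix_a.
have supp i j : coef2 a i j != 0 -> (n %| i)%N && (n %| j)%N.
  move=> aij; apply/andP; split; rewrite (prim_order_dvd w_prim).
    have := congr1 (fun c : cseries2 K => coef2 c i j) (fix_a (1, 0)%N).
    by rewrite /= mul1n mul0n addn0 -{2}[coef2 a i j]mul1r => /(mulIf aij) ->.
  have := congr1 (fun c : cseries2 K => coef2 c i j) (fix_a (0, 1)%N).
  by rewrite /= mul1n mul0n add0n -{2}[coef2 a i j]mul1r => /(mulIf aij) ->.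
have cb : convergent2 (Series2 (fun i j => coef2 a (i * n) (j * n))).
  have [r [M [r0 aM]]] := (convergent2P _).1 (cseries2_convergent a).
  apply/convergent2P; exists (r ^+ n), M; split; first exact: exprn_gt0.
  by move=> i j; rewrite /= -exprM mulnDr (mulnC n i) (mulnC n j); exact: aM.
exists (cseries2_of cb); apply: val_inj; apply: series2P => i j /=.
case: ifP => [/andP[ni nj]|nij]; first by rewrite !divnK.
by apply/esym/eqP; apply: contraFT nij => /supp.
Qed.

Lemma twist_poly_fixed P : (forall e, map_poly (twist e) P = P) ->
  exists Q, map_poly (ramify n) Q = P.
Proof.
move=> fixP; have /choice[b bP] : forall i, exists b, ramify n b = P`_i.
  by move=> i; apply: twist_fixed => e; rewrite -{2}(fixP e) coef_map.
exists (\poly_(i < size P) b i); apply/polyP => i; rewrite coef_map /= coef_poly.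
by case: ltnP => [_|/(nth_default 0) ->]; rewrite ?bP ?rmorph0.
Qed.

Local Notation G := ('I_n * 'I_n)%type.

Definition conj_act (g : G) a : cseries2 K := twist (g.1 : nat, g.2 : nat) a.

Lemma twist_mod e a : twist e a = twist (e.1 %% n, e.2 %% n)%N a.
Proof.
apply: val_inj; apply: series2P => i j /=; congr (_ * _).
by rewrite !exprD !exprM !(prim_expr_mod w_prim).
Qed.

Lemma twist_comp e e' a :
  twist e (twist e' a) = twist (e.1 + e'.1, e.2 + e'.2)%N a.
Proof.
apply: val_inj; apply: series2P => i j /=.
by rewrite mulrA -exprD !mulnDl addnACA.
Qed.

Lemma conj_actD g h a : conj_act (g + h) a = conj_act g (conj_act h a).
Proof. by rewrite /conj_act twist_comp [RHS]twist_mod. Qed.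

Lemma conj_act0 a : conj_act 0 a = a.
Proof.
apply: val_inj; apply: series2P => i j /=.
by rewrite !mul0n expr0 mul1r.
Qed.

Lemma twist_conj e : exists g, twist e =1 conj_act g.
Proof.
exists (inord (e.1 %% n), inord (e.2 %% n)) => a.
by rewrite twist_mod /conj_act /= !inordK ?ltn_mod.
Qed.

Definition conj_orbit a : seq (cseries2 K) := undup [seq conj_act g a | g : G].

Lemma mem_conj_orbit a r :
  reflect (exists g, r = conj_act g a) (r \in conj_orbit a).
Proof.
rewrite mem_undup; apply: (iffP mapP) => [[g _ ->]|[g ->]]; exists g => //.
by rewrite mem_enum.
Qed.

Definition orbit_poly a := \prod_(r <- conj_orbit a) ('X - r%:P).

Lemma size_orbit_poly a : size (orbit_poly a) = (size (conj_orbit a)).+1.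
Proof. by rewrite size_prod_XsubC. Qed.

Lemma twist_inj e : injective (twist e).
Proof.
move=> a b; have [g gE] := twist_conj e; rewrite !gE => /(congr1 (conj_act (- g))).
by rewrite -!conj_actD addNr !conj_act0.
Qed.

Lemma orbit_poly_fixed e a : map_poly (twist e) (orbit_poly a) = orbit_poly a.
Proof.
rewrite /orbit_poly rmorph_prod /=.
under eq_bigr => r _ do rewrite map_polyXsubC.
rewrite -(big_map (twist e) xpredT (fun r => 'X - r%:P)).
apply: perm_big; apply: uniq_perm.
- by rewrite map_inj_uniq ?undup_uniq//; exact: twist_inj.
- exact: undup_uniq.
move=> r; have [g gE] := twist_conj e; apply/mapP/mem_conj_orbit.
  move=> [s /mem_conj_orbit[h ->] ->]; exists (g + h).
  by rewrite conj_actD gE.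
move=> [h ->]; exists (conj_act (- g + h) a).
  by apply/mem_conj_orbit; exists (- g + h).
by rewrite gE -conj_actD addrA subrr add0r.
Qed.

Lemma orbit_poly_descends a : exists Q, [/\ Q \is monic,
  map_poly (ramify n) Q = orbit_poly a & size Q = (size (conj_orbit a)).+1].
Proof.
have [Q QE] := twist_poly_fixed (fun e => orbit_poly_fixed e a).
have sQ : size Q = (size (conj_orbit a)).+1.
  rewrite -size_orbit_poly -QE size_map_inj_poly ?rmorph0//.
  exact: ramify_inj.
exists Q; split=> //; apply/eqP; apply: (@ramify_inj K n').
rewrite rmorph1 -(lead_coef_map_inj (@ramify_inj K n') (rmorph0 _)) QE.
exact/monicP/monic_prod_XsubC.
Qed.

Lemma conj_root P a g : root (map_poly (ramify n) P) a ->
  root (map_poly (ramify n) P) (conj_act g a).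
Proof.
rewrite !rootE => /eqP Pa; apply/eqP.
have -> : map_poly (ramify n) P =
    map_poly (twist (g.1 : nat, g.2 : nat)) (map_poly (ramify n) P).
  by apply/polyP => i; rewrite !coef_map /= twist_ramify.
by rewrite /conj_act horner_map Pa rmorph0.
Qed.

Lemma root_orbit_poly a : root (orbit_poly a) a.
Proof.
have aorb : a \in conj_orbit a by apply/mem_conj_orbit; exists 0; rewrite conj_act0.
rewrite rootE horner_prod (big_rem a)//=.
by rewrite hornerXsubC subrr mul0r.
Qed.

(** The orbit polynomial descends to a monic [Q] that vanishes at [a]. All conjugates of [a] are
    roots of [P] and [P] has minimal degree, so the degrees agree. Were [P] and [Q] distinct, their
    difference would vanish at [a] and have smaller degree. *)
Lemma min_poly_orbit a P : min_poly n a P ->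
  map_poly (ramify n) P = orbit_poly a.
Proof.
move=> [Pm Pa Pmin]; have [Q [Qm QE sQ]] := orbit_poly_descends a.
have Qa : frac_root n Q a by rewrite /frac_root QE; exact: root_orbit_poly.
have mono (S : {poly cseries2 K}) : S \is monic -> map_poly (ramify n) S \is monic.
  by move=> Sm; exact: monic_map.
have sP : size P = size Q.
  apply/eqP; rewrite eqn_leq Pmin ?monic_neq0//= sQ.
  rewrite -(size_map_inj_poly (@ramify_inj K n') (rmorph0 _) P).
  apply: size_roots_monic; first exact: cseries2_domain.
  - exact: mono.
  - exact: undup_uniq.
  - by apply/allP => r /mem_conj_orbit[g ->]; exact: conj_root.
suff -> : P = Q by [].
apply/eqP; rewrite -subr_eq0; apply/negP => /negP PQ.
have : frac_root n (P - Q) a.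
  by rewrite /frac_root rootE rmorphB hornerD hornerN (eqP Pa) (eqP Qa) subr0.
move/(Pmin _ PQ); rewrite leqNgt.
have sP0 : (0 < size P)%N by rewrite size_poly_gt0 monic_neq0.
have -> // : (size (P - Q)%R < size P)%N.
rewrite -[size P]prednK// ltnS; apply/leq_sizeP => i.
rewrite leq_eqVlt coefB => /orP[/eqP <-|iP].
  by move: Pm Qm; rewrite !monicE !lead_coefE -sP => /eqP -> /eqP ->; rewrite subrr.
by rewrite !nth_default ?subrr// -?sP -[size P]prednK.
Qed.

Definition stab a : {set G} := [set g | conj_act g a == a]%SET.

Lemma card_conj_fibre a h :
  #|[set g : G | conj_act g a == conj_act h a]%SET| = #|stab a|.
Proof.
rewrite -[RHS](card_imset _ (addrI h)); apply: eq_card => g.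
rewrite inE; apply/eqP/imsetP => [gh|[k]]; last first.
  by rewrite inE => /eqP ka ->; rewrite conj_actD ka.
exists (- h + g); last by rewrite addrA subrr add0r.
by rewrite inE conj_actD gh -conj_actD addNr conj_act0.
Qed.

Lemma count_conj_orbit a r : r \in conj_orbit a ->
  count_mem r [seq conj_act g a | g : G] = #|stab a|.
Proof.
move=> /mem_conj_orbit[h ->]; rewrite count_map -(card_conj_fibre a h).
rewrite -sum1_count -sum1_card big_enum_cond; apply: eq_bigl => g.
by rewrite !inE.
Qed.

Lemma prod_conj a :
  \prod_(g : G) ('X - (conj_act g a)%:P) = orbit_poly a ^+ #|stab a|.
Proof.
have -> : \prod_(g : G) ('X - (conj_act g a)%:P) =
    \prod_(r <- [seq conj_act g a | g : G]) ('X - r%:P).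
  by rewrite big_image.
rewrite -big_undup_iterop_count /orbit_poly -prodrXl.
rewrite !big_seq; apply: eq_bigr => r rorb.
by rewrite (count_conj_orbit rorb).
Qed.

(** The orbit formula, read off from the degrees in [prod_conj]. *)
Lemma card_orbit_stab a : (size (conj_orbit a) * #|stab a| = n * n)%N.
Proof.
have := congr1 (fun p : {poly cseries2 K} => size p) (prod_conj a).
rewrite size_monic_exp ?monic_prod_XsubC// size_orbit_poly.
have eG : size (index_enum G) = #|{: G}|.
  rewrite cardE; apply: perm_size; apply: uniq_perm.
  - exact: index_enum_uniq.
  - exact: enum_uniq.
  - by move=> g; rewrite mem_index_enum mem_enum.
by rewrite size_prod_XsubC eG card_prod !card_ord /= => -[<-].
Qed.

End Action.

(** Division by the monic [F] leaves a remainder that vanishes at [a] and is shorter than [F], hence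
    is 0. One factor of f = q F is a unit, and a monic unit is 1; [F = 1] is excluded by its
    root. *)
Lemma irreducible_min_poly (K : numFieldType) (n' : nat) (f F : {poly cseries2 K})
    (a : cseries2 K) :
  irreducible_elt f -> f \is monic -> frac_root n'.+1 f a ->
  min_poly n'.+1 a F -> f = F.
Proof.
move=> [_ _ firr] fm fa [Fm Fa Fmin].
have fE := Pdiv.RingMonic.rdivp_eq Fm f.
set q := Pdiv.CommonRing.rdivp f F in fE; set r := Pdiv.CommonRing.rmodp f F in fE.
have r0 : r = 0.
  apply/eqP; apply/negP => /negP rN0.
  have : frac_root n'.+1 r a.
    have -> : r = f - q * F by rewrite {1}fE addrAC subrr add0r.
    rewrite /frac_root rootE rmorphB rmorphM hornerD hornerN hornerM.
    by rewrite (eqP fa) (eqP Fa) mulr0 subr0.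
  move/(Fmin _ rN0); rewrite leqNgt Pdiv.CommonRing.ltn_rmodp.
  by rewrite monic_neq0.
rewrite r0 addr0 in fE; clearbody q; clear r r0.
have unit1 (g : {poly cseries2 K}) : g \is monic -> is_unit g -> g = 1.
  move=> gm [b gb]; apply: monic_size1 => //; have b0 : b != 0.
    by apply/eqP => b0; move: gb => /esym/eqP; rewrite b0 mulr0 oner_eq0.
  have := congr1 (fun p : {poly cseries2 K} => size p) gb.
  rewrite size_poly1 (size_monicM gm b0).
  have : (0 < size g)%N by rewrite size_poly_gt0 monic_neq0.
  move: b0; rewrite -size_poly_gt0.
  by case: (size g) (size b) => [|[|k]] [|l] //=; rewrite addnS.
have qm : q \is monic by rewrite -(monicMr _ Fm) -fE.
have [/(unit1 q qm) q1|/(unit1 F Fm) F1] := firr _ _ fE.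
  by rewrite fE q1 mul1r.
by move: Fa; rewrite F1 /frac_root rmorph1 rootE hornerE oner_eq0.
Qed.

(** * The lattices of the characteristic exponents and their duals *)

Section Lattice.
Variables (n' g : nat) (lam : nat -> rat * rat).
Local Notation n := n'.+1.
Local Notation M := (latM lam).
Implicit Types (u v : rat * rat).

Lemma latM_0 k : M k 0.
Proof.
elim: k => [|k IH] /=; first by split; exact: rpred0.
by exists 0 => //; exists 0; rewrite mulr0z addr0.
Qed.

Lemma latMB k u v : M k u -> M k v -> M k (u - v).
Proof.
elim: k u v => [|k IH] u v /=.
  by move=> [u1 u2] [v1 v2]; split; apply: rpredB.
move=> [u' Mu [a ->]] [v' Mv [b ->]]; exists (u' - v'); first exact: IH.
by exists (a - b); rewrite mulrzBr opprD addrACA.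
Qed.

Lemma latMN k v : M k v -> M k (- v).
Proof. by move=> Mv; rewrite -sub0r; apply: latMB => //; exact: latM_0. Qed.

Lemma latMD k u v : M k u -> M k v -> M k (u + v).
Proof. by move=> Mu /latMN Mv; rewrite -[v]opprK; exact: latMB. Qed.

Lemma latM_S k v : M k v -> M k.+1 v.
Proof. by move=> Mv; exists v => //; exists 0; rewrite mulr0z addr0. Qed.

Lemma latM_le k l v : (k <= l)%N -> M k v -> M l v.
Proof.
move=> /subnK <-; elim: (l - k)%N => // d IH Mv; rewrite addSn.
by apply: latM_S; exact: IH.
Qed.

Lemma latM_lam k : M k.+1 (lam k.+1).
Proof. by exists 0; [exact: latM_0|exists 1; rewrite add0r mulr1z]. Qed.

Lemma latM_int k (a b : int) : M k (a%:~R, b%:~R).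
Proof. by apply: (latM_le (leq0n k)); split; exact: intr_int. Qed.

Lemma latM_modn k i j : M k (frac_exp n (i %% n) (j %% n)) <-> M k (frac_exp n i j).
Proof.
have nN0 : n%:R != 0 :> rat by rewrite pnatr_eq0.
have -> : frac_exp n i j = frac_exp n (i %% n) (j %% n) +
    (((i %/ n)%:Z)%:~R, ((j %/ n)%:Z)%:~R).
  rewrite {1}(divn_eq i n) {1}(divn_eq j n) /frac_exp.
  by congr pair; rewrite /= natrD natrM mulrDl mulfK// addrC.
split=> [Mij|/latMB/(_ (latM_int k (i %/ n)%:Z (j %/ n)%:Z))].
  by apply: latMD => //; exact: latM_int.
by rewrite addrK.
Qed.

Local Notation G := ('I_n * 'I_n)%type.

(** Representatives of M_k / Z^2, provided that M_k lies in (1/n) Z^2. *)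
Definition lat_class k : {set G} := [set v : G | `[< M k (frac_exp n v.1 v.2)
  >]]%SET.

(** Representatives of N_k / n Z^2 under the same proviso: the conjugations that fix every monomial
    with exponent in M_k, that is, the annihilator of [lat_class k]. *)
Definition dual_class k : {set G} :=
  [set e : G | `[< sigma_latN lam k (e.1 : nat, e.2 : nat) >]]%SET.

Lemma lat_classP k (v : G) : reflect (M k (frac_exp n v.1 v.2)) (v \in lat_class k).
Proof. by rewrite inE; exact: asboolP. Qed.

Lemma dual_classP k (e : G) :
  reflect (sigma_latN lam k (e.1 : nat, e.2 : nat)) (e \in dual_class k).
Proof. by rewrite inE; exact: asboolP. Qed.

Lemma frac_expD i j i' j' :
  frac_exp n (i + i') (j + j') = frac_exp n i j + frac_exp n i' j'.
Proof. by rewrite /frac_exp !natrD !mulrDl. Qed.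

Lemma lat_class_add k (u v : G) :
  u + v \in lat_class k <-> M k (frac_exp n u.1 u.2 + frac_exp n v.1 v.2).
Proof.
rewrite -frac_expD -latM_modn.
by split=> [/lat_classP|h]; last exact/lat_classP.
Qed.

Lemma lat_classD k (u v : G) : v \in lat_class k ->
  (u + v \in lat_class k) = (u \in lat_class k).
Proof.
move=> /lat_classP Mv; apply/idP/idP => [/lat_class_add/latMB/(_ Mv)|/lat_classP Mu].
  by rewrite addrK => h; exact/lat_classP.
by apply/lat_class_add; exact: latMD.
Qed.

Lemma lat_class0 k : 0 \in lat_class k.
Proof. by apply/lat_classP; rewrite /frac_exp /= mul0r; exact: latM_0. Qed.

Lemma lat_class_sub k (u v : G) :
  M k (frac_exp n u.1 u.2 - frac_exp n v.1 v.2) <-> u - v \in lat_class k.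
Proof.
have uE := lat_class_add k (u - v) v; rewrite subrK in uE.
have vE := lat_class_add k (- v) v; rewrite addNr lat_class0 in vE.
have Mnv := vE.1 isT; rewrite (lat_class_add k u (- v)).
have -> : frac_exp n u.1 u.2 - frac_exp n v.1 v.2 =
    frac_exp n u.1 u.2 + frac_exp n (- v).1 (- v).2 -
    (frac_exp n (- v).1 (- v).2 + frac_exp n v.1 v.2).
  by rewrite opprD addrA addrK.
by split=> [/latMD/(_ Mnv)|/latMB]; [rewrite subrK|apply].
Qed.

Lemma frac_exp_modZ (i j : int) : exists (u : G) (a b : int),
  frac_exp n u.1 u.2 = (i%:~R / n%:R, j%:~R / n%:R) - (a%:~R, b%:~R).
Proof.
have nN0 : n%:R != 0 :> rat by rewrite pnatr_eq0.
have mE (a : int) : (inord `|(a %% n)%Z| : 'I_n)%:R / n%:R =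
    a%:~R / n%:R - (a %/ n)%Z%:~R :> rat.
  have an : (`|(a %% n)%Z| < n)%N.
    by rewrite -ltz_nat gez0_abs ?modz_ge0// ltz_pmod.
  have aE : a%:~R = (a %/ n)%Z%:~R * n%:R + (a %% n)%Z%:~R :> rat.
    by rewrite {1}(divz_eq a n) intrD intrM.
  rewrite inordK// aE mulrDl mulfK// addrAC subrr add0r.
  by rewrite natr_absz ger0_norm// modz_ge0.
exists (inord `|(i %% n)%Z|, inord `|(j %% n)%Z|), (i %/ n)%Z, (j %/ n)%Z.
by rewrite /frac_exp; congr pair; rewrite /= mE.
Qed.

(** Each coset of [M_k] in [M_(k+1)] meets [0, 1)^2 in as many points of
    [(1/n) Z^2] as [M_k] does. *)
Lemma card_lat_class k :
  (forall v, M k.+1 v -> exists i j : int, v = (i%:~R / n%:R, j%:~R / n%:R)) ->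
  #|lat_class k.+1| = (idx lam k.+1 * #|lat_class k|)%N.
Proof.
move=> fracM; rewrite /idx /lat_index /=.
pose c (v : G) : set (rat * rat) := [set y | M k (y - frac_exp n v.1 v.2)].
set C := [set _ | _ in _].
have cE (u v : G) : c u = c v <-> u - v \in lat_class k.
  rewrite -lat_class_sub; split=> [uv|Muv].
    have : c v (frac_exp n u.1 u.2) by rewrite -uv /c /= subrr; exact: latM_0.
    by [].
  apply/seteqP; split=> y; rewrite /c /= => My.
    by have := latMD My Muv; rewrite addrA subrK.
  by have := latMB My Muv; rewrite opprB addrA subrK.
have CE : C = c @` [set` lat_class k.+1].
  apply/seteqP; split=> [_ [x Mx <-]|_ [v /lat_classP Mv <-]]; last first.
    by exists (frac_exp n v.1 v.2).
  have [i [j xE]] := fracM x Mx; have [v [a [b vx]]] := frac_exp_modZ i j.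
  rewrite -xE in vx.
  have Mv : M k.+1 (frac_exp n v.1 v.2) by rewrite vx; apply: latMB => //;
    exact: latM_int.
  exists v; first exact/lat_classP.
  apply/seteqP; split=> y; rewrite /c /= vx opprB => My.
    have := latMB My (latM_int k a b).
    by rewrite addrA addrAC addrK.
  have := latMD My (latM_int k a b).
  by rewrite addrAC addrA.
have Cfin : finite_set C by rewrite CE; apply: finite_image; exact: finite_finset.
have inC (v : G) : v \in lat_class k.+1 -> c v \in fset_set C.
  by move=> vS; rewrite in_fset_set// inE CE; exists v.
(* Double counting of the pairs of a class and its coset; the fibre over each coset is a translate
   of [lat_class k]. *)
transitivity (\sum_(v in lat_class k.+1) \sum_(x <- fset_set C | c v == x) 1)%N.
  rewrite -sum1_card; apply: eq_bigr => v vS; rewrite sum1_count.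
  rewrite (eq_count (a2 := pred1 (c v))); last by move=> x; rewrite /= eq_sym.
  by rewrite count_uniq_mem ?fset_uniq// inC.
rewrite (exchange_big_dep xpredT)//=.
transitivity (\sum_(x <- fset_set C) #|lat_class k|)%N; last first.
  by rewrite big_const_seq iter_addn_0 count_predT mulnC.
apply: eq_big_seq => x; rewrite in_fset_set// inE CE => -[v0 /= v0S <-].
rewrite sum1dep_card -[RHS](card_imset _ (addIr v0)); apply: eq_card => v.
have v0S' : v0 \in lat_class k.+1 by [].
rewrite inE; apply/andP/imsetP => [[vS /eqP/cE vv0]|[u uS ->]].
  by exists (v - v0); rewrite ?subrK.
rewrite lat_classD//; split; last by apply/eqP/cE; rewrite addrK.
by apply/lat_classP/latM_S/lat_classP.
Qed.

Lemma pairingD e u v : pairing e (u + v) = pairing e u + pairing e v.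
Proof. by rewrite /pairing /=; ring. Qed.

Lemma pairingN e v : pairing e (- v) = - pairing e v.
Proof. by rewrite /pairing /=; ring. Qed.

Lemma pairing_frac e i j :
  (pairing e (frac_exp n i j) \is a Num.int) = (n %| e.1 * i + e.2 * j)%N.
Proof.
have nN0 : n%:R != 0 :> rat by rewrite pnatr_eq0.
have -> : pairing e (frac_exp n i j) = (e.1 * i + e.2 * j)%N%:R / n%:R.
  by rewrite /pairing /frac_exp /= natrD !natrM; field.
apply/idP/idP => [/intrP[z zE]|/dvdnP[q ->]]; last first.
  by rewrite natrM mulfK// rpred_nat.
have : (e.1 * i + e.2 * j)%N%:Z = z * n%:Z.
  apply: (@intr_inj rat); rewrite intrM -zE divfK//.
by move=> h; have := dvdz_mull z (dvdzz n%:Z); rewrite -h.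
Qed.

Lemma frac_pairing_mod k (e : nat * nat) v :
  (forall v, M k v -> exists i j : int, v = (i%:~R / n%:R, j%:~R / n%:R)) ->
  M k v -> exists2 u : G, u \in lat_class k &
    pairing e v - pairing e (frac_exp n u.1 u.2) \is a Num.int.
Proof.
move=> fracM Mv; have [i [j vE]] := fracM v Mv.
have [u [a [b ux]]] := frac_exp_modZ i j; rewrite -vE in ux.
exists u; first by apply/lat_classP; rewrite ux; apply: latMB => //; exact: latM_int.
rewrite ux pairingD pairingN opprD opprK addrA subrr add0r /pairing /=.
by rewrite rpredD// rpredM ?intr_int ?rpred_nat.
Qed.

Variables (K : numFieldType) (w : K).
Hypothesis w_prim : n.-primitive_root w.

Definition pair_char (v e : G) : K := w ^+ (e.1 * v.1 + e.2 * v.2).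

Lemma pair_char_eq1 (v e : G) : (pair_char v e == 1) =
  (pairing (e.1 : nat, e.2 : nat) (frac_exp n v.1 v.2) \is a Num.int).
Proof. by rewrite pairing_frac /pair_char -(prim_order_dvd w_prim). Qed.

Lemma pair_charDl (u v e : G) : pair_char (u + v) e = pair_char u e * pair_char v e.
Proof.
have wmod p x : w ^+ (p * (x %% n)) = w ^+ (p * x).
  by rewrite mulnC exprM (prim_expr_mod w_prim) -exprM mulnC.
rewrite /pair_char exprD.
have -> : nat_of_ord (u + v).1 = ((u.1 + v.1) %% n)%N by [].
have -> : nat_of_ord (u + v).2 = ((u.2 + v.2) %% n)%N by [].
by rewrite !wmod -!exprD !mulnDr addnACA.
Qed.

Lemma pair_charC (u v : G) : pair_char u v = pair_char v u.
Proof. by rewrite /pair_char mulnC [(v.2 * _)%N]mulnC. Qed.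

(** Translation by [u] permutes the terms and multiplies the sum by a factor different from 1. *)
Lemma char_sum_eq0 (A : {set G}) (u e : G) :
  (forall v : G, (v + u \in A) = (v \in A)) -> pair_char u e != 1 ->
  \sum_(v : G | v \in A) pair_char v e = 0.
Proof.
move=> uA ue; have : (pair_char u e - 1) * \sum_(v : G | v \in A) pair_char v e = 0.
  rewrite mulrBl mul1r [X in _ - X](reindex_inj (addIr u)) /= mulr_sumr.
  under [X in _ - X]eq_bigl => v do rewrite uA.
  under [X in _ - X]eq_bigr => v _ do rewrite pair_charDl mulrC.
  by rewrite subrr.
by move=> /eqP; rewrite mulf_eq0 subr_eq0 (negbTE ue) => /eqP.
Qed.

(** Duality, by summing the characters [w ^ <e, n v>] over both classes. *)
Lemma card_lat_dual k :
  (forall v, M k v -> exists i j : int, v = (i%:~R / n%:R, j%:~R / n%:R)) ->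
  (#|lat_class k| * #|dual_class k| = n * n)%N.
Proof.
move=> fracM; apply/eqP; rewrite -(eqr_nat K); apply/eqP.
transitivity (\sum_(e : G) \sum_(v : G | v \in lat_class k) pair_char v e).
  rewrite (bigID (mem (dual_class k)))/= [X in _ + X]big1 ?addr0.
    rewrite (eq_bigr (fun=> #|lat_class k|%:R)).
      by rewrite sumr_const natrM mulr_natr.
    move=> e /dual_classP eH; rewrite (eq_bigr (fun=> 1)) ?sumr_const//.
    by move=> v /lat_classP Mv; apply/eqP; rewrite pair_char_eq1; exact: eH.
  move=> e eH; have [u uS ue] : exists2 u : G, u \in lat_class k & pair_char u
    e != 1.
    apply: contrapT => noc; move/negP: eH; apply; apply/dual_classP => v Mv.
    have [u uS] := frac_pairing_mod (e.1 : nat, e.2 : nat) fracM Mv.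
    have [ue|ue] := boolP (pair_char u e == 1); last by case: noc; exists u.
    by rewrite pair_char_eq1 in ue => /rpredD/(_ ue); rewrite subrK.
  by apply: (char_sum_eq0 (u := u)) => // v; exact: lat_classD.
(* Summed over e first, only v = 0 contributes: a nonzero v defines a nontrivial character of
   (Z/n)^2, detected on a basis vector. *)
rewrite exchange_big /= (bigD1 (0 : G)) ?lat_class0//= [X in _ + X]big1 ?addr0.
  rewrite (eq_bigr (fun=> 1)); last by move=> e _; rewrite /pair_char !muln0 expr0.
  by rewrite sumr_const card_prod !card_ord.
move=> v /andP[_ v0].
have [u uv] : exists u : G, pair_char u v != 1.
  have lt1 (i : 'I_n) : i != 0 -> (1 < n)%N /\ w ^+ i != 1.
    move=> i0; have i_gt0 : (0 < i)%N by rewrite lt0n.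
    split; first exact: leq_ltn_trans i_gt0 (ltn_ord i).
    by rewrite -(prim_order_dvd w_prim) gtnNdvd.
  have [v1|/lt1[n1 v1]] := eqVneq v.1 0; last first.
    exists (inord 1, 0); rewrite /pair_char /= inordK//.
    by rewrite muln1 muln0 addn0.
  have [v2|/lt1[n1 v2]] := eqVneq v.2 0; last first.
    exists (0, inord 1); rewrite /pair_char /= inordK//.
    by rewrite muln1 muln0 add0n.
  by case/eqP: v0; case: v v1 v2 => v1 v2 /= -> ->.
rewrite (eq_bigr (fun e => pair_char e v)); last by move=> e _; rewrite pair_charC.
apply: etrans (char_sum_eq0 (A := [set: G]%SET) _ uv).
  by apply: eq_bigl => e; rewrite finset.in_setT.
by move=> e; rewrite !finset.in_setT.
Qed.
End Lattice.

Lemma pair_mulrz (v : rat * rat) z : v *~ z = (v.1 * z%:~R, v.2 * z%:~R).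
Proof.
rewrite !mulrzr [LHS]surjective_pairing.
by rewrite (raddfMz (@fst rat rat)) (raddfMz (@snd rat rat)).
Qed.

(** * Stabilizers and contact orders *)

Section CharExp.
Variables (K : numFieldType) (n' g : nat) (lam : nat -> rat * rat).
Local Notation n := n'.+1.
Variables (w : K) (zeta : cseries2 K).
Hypothesis w_prim : n.-primitive_root w.
Hypothesis lamP : char_exponents n zeta g lam.
Local Notation G := ('I_n * 'I_n)%type.
Local Notation M := (latM lam).
Local Notation H := (dual_class n' lam).
Implicit Types (e : G) (j k l : nat).

Let nN0 : n%:R != 0 :> rat. Proof. by rewrite pnatr_eq0. Qed.

Lemma beta_frac i j : beta n zeta (frac_exp n i j) = coef2 zeta i j.
Proof. by rewrite /beta /frac_exp /= ![n%:R * _]mulrC !divfK// !natr_nat !natrK. Qed.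

Lemma char_frac : exists ab : nat -> nat * nat, forall k, (0 < k <= g)%N ->
  lam k = frac_exp n (ab k).1 (ab k).2 /\ coef2 zeta (ab k).1 (ab k).2 != 0.
Proof.
suff /choice[ab abP] : forall k, exists ab : nat * nat, (0 < k <= g)%N ->
    lam k = frac_exp n ab.1 ab.2 /\ coef2 zeta ab.1 ab.2 != 0 by exists ab.
move=> k; have [kg|_] := boolP (0 < k <= g)%N; last by exists (0, 0)%N.
have := char_beta lamP kg.
have [/andP[/natrP[a ka] /natrP[b kb]] bN0|nok] :=
  boolP ((n%:R * (lam k).1 \is a Num.nat) && (n%:R * (lam k).2 \is a Num.nat));
  last by rewrite /beta (negbTE nok).
exists (a, b) => _.
have lamE : lam k = frac_exp n a b.
  rewrite /frac_exp -ka -kb !(mulrC n%:R) !mulfK//.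
  by case: (lam k).
by split=> //; rewrite -beta_frac -lamE; apply/eqP.
Qed.

Lemma latM_frac k v : (k <= g)%N -> M k v ->
  exists i j : int, v = (i%:~R / n%:R, j%:~R / n%:R).
Proof.
elim: k v => [|k IH] v kg /=.
  move=> [/intrP[a va] /intrP[b vb]]; exists (a * n), (b * n).
  by rewrite !intrM !mulfK// -va -vb; case: v {va vb}.
move=> [u Mu [z ->]]; have [i [j ->]] := IH u (ltnW kg) Mu.
have [ab abP] := char_frac; have [-> _] := abP k.+1 kg.
exists (i + (ab k.+1).1%:Z * z), (j + (ab k.+1).2%:Z * z).
rewrite pair_mulrz /frac_exp; congr pair; rewrite /= !intrD !intrM mulrDl.
  by rewrite [X in _ + X = _]mulrAC.
by rewrite [X in _ + X = _]mulrAC.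
Qed.

Lemma dual_class_sub k : H k.+1 \subset H k.
Proof.
apply/fintype.subsetP => e /dual_classP He; apply/dual_classP => v /latM_S.
exact: He.
Qed.

Lemma dual_class_le k l e : (k <= l)%N -> e \in H l -> e \in H k.
Proof.
move=> /subnK <-; elim: (l - k)%N => // d IH; rewrite addSn => He.
by apply: IH; exact: (fintype.subsetP (dual_class_sub _)).
Qed.

Lemma card_dual0 : #|H 0| = (n * n)%N.
Proof.
have -> : H 0 = [set: G]%SET; last by rewrite cardsT card_prod !card_ord.
apply/setP => e; rewrite finset.in_setT; apply/dual_classP => v [v1 v2].
by rewrite /pairing rpredD// rpredM ?rpred_nat.
Qed.

(** The classes of M_k and of its dual have sizes with product n^2 for every k, so the index n_(k+1)
    reappears, reversed, between the duals. *)
Lemma card_dualS k : (k < g)%N -> #|H k| = (idx lam k.+1 * #|H k.+1|)%N.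
Proof.
move=> kg; have c1 := card_lat_dual w_prim (fun v => @latM_frac k v (ltnW kg)).
have c2 := card_lat_dual w_prim (fun v => @latM_frac k.+1 v kg).
have c3 := card_lat_class (fun v => @latM_frac k.+1 v kg).
have Sk : (0 < #|lat_class n' lam k|)%N.
  by apply/card_gt0P; exists 0; exact: lat_class0.
apply/eqP; rewrite -(eqn_pmul2l Sk) c1 -c2 c3.
by rewrite -!mulnA mulnCA.
Qed.

Lemma card_dual k : (k <= g)%N -> #|H k| = (#|H g| * prod_idx lam k.+1 g)%N.
Proof.
move=> /subnKC; move: (g - k)%N => d; elim: d k => [|d IH] k kd.
  by rewrite /prod_idx -kd addn0 big_geq ?muln1.
have kg : (k < g)%N by rewrite -kd addnS ltnS leq_addr.
rewrite card_dualS// (IH k.+1) ?addSnnS//.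
by rewrite [in RHS]/prod_idx big_ltn ?ltnS// mulnCA.
Qed.

Lemma char_mono k l : (0 < k)%N -> (k <= l)%N -> (l <= g)%N ->
  le_exp (lam k) (lam l).
Proof.
move=> k0 /subnK <-; elim: (l - k)%N => [|d IH]; first by rewrite /le_exp !lexx.
rewrite addSn => kg; have := char_le lamP (j := (d + k)%N).
rewrite kg (leq_trans k0) ?leq_addl// => /(_ isT) /andP[h1 h2].
have /andP[h3 h4] := IH (ltnW kg).
by rewrite /le_exp (le_trans h3)//= (le_trans h4).
Qed.

(** Descent on k to the largest characteristic exponent below the given one; it stops at the latest
    at lambda_0 = 0. *)
Lemma char_supp_lat i j k : (k <= g)%N -> coef2 zeta i j != 0 ->
  ((k < g)%N -> ~~ le_exp (lam k.+1) (frac_exp n i j)) -> M k (frac_exp n i j).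
Proof.
move=> kg zij; have bN0 : beta n zeta (frac_exp n i j) <> 0.
  by rewrite beta_frac; apply/eqP.
elim: k kg => [|k IH] kg knle.
  apply: (char_supp lamP bN0) => //; rewrite (char_lam0 lamP).
  by rewrite /le_exp /= !divr_ge0.
have [le|nle] := boolP (le_exp (lam k.+1) (frac_exp n i j)).
  exact: (char_supp lamP bN0 kg le).
by apply: latM_S; apply: IH => //; exact: ltnW.
Qed.

Lemma coef2_conj e (a : cseries2 K) i j k : e \in H k -> M k (frac_exp n i j) ->
  coef2 (conj_act w_prim e a) i j = coef2 a i j.
Proof.
move=> /dual_classP He Mij; rewrite /=.
have := He _ Mij; rewrite pairing_frac /= (prim_order_dvd w_prim) => /eqP ->.
by rewrite mul1r.
Qed.

Local Notation zeta_ j := (trunc_root n zeta g lam j).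

(** An element that fixes zeta_j fixes the monomials of lambda_1, ..., lambda_j, which occur in it,
    so it pairs integrally with generators of M_j. Conversely, all exponents of zeta_j lie in
    M_j. *)
Lemma stab_trunc_root j : (0 < j <= g)%N -> stab w_prim (zeta_ j) = H j.
Proof.
move=> /andP[j0 jg]; apply/setP => e; rewrite inE;
  apply/eqP/dual_classP => [fix_e|He].
  have [ab abP] := char_frac.
  have int_lam k : (0 < k <= j)%N -> pairing (e.1 : nat, e.2 : nat) (lam k) \is
    a Num.int.
    move=> /andP[k0 kj]; have kg := leq_trans kj jg.
    have [lamE cN0] := abP k (introT andP (conj k0 kg)).
    have := congr1 (fun c : cseries2 K => coef2 c (ab k).1 (ab k).2) fix_e.
    rewrite /= -lamE; case: ifP => [/andP[jltg le]|_].
      (* If the term of lambda_k were cut off, then lambda_(j+1) = lambda_k would lie in M_j. *)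
      have /andP[h1 h2] := le; have /andP[h3 h4] := char_mono k0 (leqW kj) jltg.
      have lamjk : lam j.+1 = lam k.
        apply/eqP; rewrite -pair_eqE; apply/andP.
        by split; apply/eqP/le_anti; [rewrite h1 h3|rewrite h2 h4].
      case: (@char_notin _ _ _ _ _ lamP j.+1); first by rewrite jltg.
      rewrite lamjk /=; apply: (latM_le kj).
      by case: k k0 {kj kg lamE cN0 le h1 h2 h3 h4 lamjk} => // k _; exact: latM_lam.
    rewrite lamE pairing_frac /= (prim_order_dvd w_prim).
    by rewrite -{2}[coef2 zeta _ _]mul1r => /(mulIf cN0) ->.
  move=> v; elim: j j0 jg v {fix_e} int_lam => // j IH _ jg v int_lam.
  move=> [u Mu [z ->]]; rewrite pairingD.
  have -> : pairing (e.1 : nat, e.2 : nat) (lam j.+1 *~ z) =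
      pairing (e.1 : nat, e.2 : nat) (lam j.+1) *~ z.
    by rewrite -mulrzr pair_mulrz /pairing /=; ring.
  rewrite rpredD//; last first.
    by rewrite -mulrzr rpredM ?intr_int// int_lam// ltnSn.
  case: j IH jg int_lam Mu => [|j] IH jg int_lam Mu.
    by move: Mu => [u1 u2]; rewrite /pairing rpredD// rpredM ?rpred_nat.
  apply: IH => //; first exact: ltnW.
  by move=> k /andP[k0 kj]; apply: int_lam; rewrite k0 ltnW.
apply: val_inj; apply: series2P => i l /=.
case: ifP => [_|/negbT nle]; first by rewrite mulr0.
have [->|zN0] := eqVneq (coef2 zeta i l) 0; first by rewrite mulr0.
have := @coef2_conj e zeta i l j; apply; first exact/dual_classP.
by apply: char_supp_lat => // jltg; move: nle; rewrite jltg.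
Qed.

Variables (ab : nat -> nat * nat) (nu : nat * nat).
Hypothesis abP : forall k, (0 < k <= g)%N ->
  lam k = frac_exp n (ab k).1 (ab k).2 /\ coef2 zeta (ab k).1 (ab k).2 != 0.

Definition char_order k := (nu.1 * (ab k).1 + nu.2 * (ab k).2)%N.
Local Notation W := char_order.

Lemma char_orderE k : (0 < k <= g)%N -> (W k)%:R = n%:R * pairing nu (lam k).
Proof.
move=> /abP[-> _]; rewrite /pairing /frac_exp /= /char_order natrD !natrM.
by field.
Qed.

Lemma le_frac_exp a b i j :
  le_exp (frac_exp n a b) (frac_exp n i j) = (a <= i)%N && (b <= j)%N.
Proof.
by rewrite /le_exp /frac_exp /= !ler_pM2r ?invr_gt0 ?ltr0n// !ler_nat.
Qed.

Lemma char_order_mono k l : (0 < k)%N -> (k <= l)%N -> (l <= g)%N -> (W k <= W l)%N.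
Proof.
move=> k0 kl lg; have := char_mono k0 kl lg.
have [-> _] := abP (introT andP (conj k0 (leq_trans kl lg))).
have [-> _] := abP (introT andP (conj (leq_trans k0 kl) lg)).
rewrite le_frac_exp => /andP[h1 h2].
by rewrite /char_order leq_add ?leq_mul.
Qed.

(** Terms with exponent not above lambda_(k+1) have their exponent in M_k; [e - e0] fixes them, so
    they cancel. *)
Lemma conj_diff_supp j k e e0 a b : (k <= j)%N -> (j < g)%N -> e - e0 \in H k ->
  coef2 (conj_act w_prim e (zeta_ j) - conj_act w_prim e0 (zeta_ j)) a b != 0 ->
  ((ab k.+1).1 <= a)%N /\ ((ab k.+1).2 <= b)%N.
Proof.
move=> kj jg ek; have kg := leq_ltn_trans kj jg.
have [lamE _] := abP (introT andP (conj (ltn0Sn k) kg)).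
have [le _|nle] := boolP (le_exp (lam k.+1) (frac_exp n a b)).
  by move: le; rewrite lamE le_frac_exp => /andP.
have -> : conj_act w_prim e (zeta_ j) =
    conj_act w_prim e0 (conj_act w_prim (e - e0) (zeta_ j)).
  by rewrite -conj_actD addrC subrK.
move/eqP; case.
have [z0|zN0] := eqVneq (coef2 zeta a b) 0.
  by rewrite /= z0 if_same !mulr0 subrr.
have Mab : M k (frac_exp n a b) by apply: char_supp_lat => //; exact: ltnW.
have := coef2_conj (zeta_ j) ek Mab; rewrite /= => ->.
by rewrite subrr.
Qed.

Lemma trunc_diff_supp j e a b :
  coef2 (conj_act w_prim e (zeta_ j) - conj_act w_prim e zeta) a b != 0 ->
  (j < g)%N -> ((ab j.+1).1 <= a)%N /\ ((ab j.+1).2 <= b)%N.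
Proof.
move=> /= h jg; have [lamE _] := abP (introT andP (conj (ltn0Sn j) jg)).
move: h; rewrite jg /=; case: ifP; last by rewrite subrr eqxx.
by rewrite lamE le_frac_exp => /andP.
Qed.

(** A telescoping sum for [W k.+1], where [k <= j] is maximal with
    [e - e0 \in H k]: this bounds from below the order of the difference of the
    conjugates of [zeta_j] by [e] and [e0]. *)
Definition contact_order j e0 e :=
  (W 1 + \sum_(1 <= k < j.+1) ((e - e0)%R \in H k) * (W k.+1 - W k))%N.

Lemma contact_order_prefix j e0 e : (j < g)%N -> e - e0 \in H j ->
  contact_order j e0 e = W j.+1.
Proof.
elim: j => [|j IH] jg ej; rewrite /contact_order; first by rewrite big_geq ?addn0.
rewrite big_nat_recr//= ej mul1n addnA.
have := IH (ltnW jg) (dual_class_le (leqnSn j) ej); rewrite /contact_order => ->.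
by rewrite subnKC// char_order_mono.
Qed.

Lemma contact_order_le j e0 e : (j < g)%N -> (contact_order j e0 e <= W j.+1)%N.
Proof.
elim: j => [|j IH] jg; rewrite /contact_order; first by rewrite big_geq ?addn0.
rewrite big_nat_recr//= addnA; have := IH (ltnW jg); rewrite /contact_order => h.
have h' := char_order_mono (ltn0Sn j) (leqnSn j.+1) jg.
case: (_ \in _); last by rewrite mul0n addn0 (leq_trans h).
by rewrite mul1n -{2}(subnKC h') leq_add2r.
Qed.

(** At the largest k <= l with [e - e0] in H_k the sum has telescoped to [W k.+1]. Such a k exists
    because H_0 is the whole group. *)
Lemma vge_contact_order (a : series2 K) j l e0 e : (j < g)%N ->
  (forall k, (k <= j)%N -> e - e0 \in H k -> vge a (W k.+1)) ->
  (l <= j)%N -> vge a (contact_order l e0 e).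
Proof.
move=> jg av; elim: l => [|l IH] lj.
  rewrite /contact_order big_geq// addn0; apply: av => //.
  by apply/dual_classP => v [v1 v2]; rewrite /pairing rpredD// rpredM ?rpred_nat.
have [el|nel] := boolP (e - e0 \in H l.+1).
  rewrite contact_order_prefix//; first exact: av.
  exact: leq_ltn_trans lj jg.
have -> : contact_order l.+1 e0 e = contact_order l e0 e.
  by rewrite /contact_order big_nat_recr//= (negbTE nel) mul0n addn0.
exact: IH (ltnW lj).
Qed.

(** Since |H_k| = n e_k and W_k = n <nu, lambda_k>, this is n^2 times the unfolded recursion e_j
    gamma_(j+1) = e_(j-1) gamma_j + e_j (lambda_(j+1) - lambda_j), which comes from n_j e_j =
    e_(j-1). *)
Lemma sum_contact_order j e0 : (j < g)%N -> #|H g| = n ->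
  (\sum_e contact_order j e0 e)%:R =
  n%:R * (n%:R * ((prod_idx lam j.+1 g)%:R * pairing nu (gamma_exp lam j.+1)))
    :> rat.
Proof.
move=> jg Hg.
have card_shift k : #|[set e : G | e - e0 \in H k]%SET| = #|H k|.
  rewrite -[RHS](card_imset _ (addIr e0)); apply: eq_card => e; rewrite inE.
  apply/idP/imsetP => [ek|[d dk ->]]; last by rewrite addrK.
  by exists (e - e0); rewrite ?subrK.
have -> : (\sum_e contact_order j e0 e =
    n * n * W 1 + \sum_(1 <= k < j.+1) #|H k| * (W k.+1 - W k))%N.
  rewrite big_split /= sum_nat_const card_prod !card_ord; congr (_ + _)%N.
  rewrite exchange_big /=; apply: eq_bigr => k _.
  rewrite -big_distrl /=; congr (_ * _)%N.
  by rewrite -card_shift -sum1dep_card [RHS]big_mkcond; apply: eq_bigr => e _;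
    case: (_ \in _).
have prodS k : (k < g)%N -> prod_idx lam k.+1 g = (idx lam k.+1 * prod_idx lam
  k.+2 g)%N.
  by move=> kg; rewrite /prod_idx big_ltn.
have Hk k : (k <= g)%N -> #|H k|%:R = n%:R * (prod_idx lam k.+1 g)%:R :> rat.
  by move=> kg; rewrite card_dual// Hg natrM.
have g0 : (0 < g)%N by exact: leq_ltn_trans jg.
rewrite natrD natrM -card_dual0 Hk// char_orderE//.
elim: j jg => [|j IH] jg.
  by rewrite big_geq// addr0 /=; ring.
have jg' := ltnW jg; have W_le := char_order_mono (ltn0Sn j) (leqnSn j.+1) jg.
rewrite big_nat_recr//= natrD addrA (IH jg') natrM (Hk _ jg') (natrB _ W_le).
rewrite !char_orderE// (prodS _ jg') natrM.
have -> : pairing nu (gamma_exp lam j.+2) =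
   (idx lam j.+1)%:R * pairing nu (gamma_exp lam j.+1) +
   pairing nu (lam j.+2) - pairing nu (lam j.+1).
  rewrite [gamma_exp _ j.+2]/= -[if _ then _ else _]/(gamma_exp lam j.+1).
  rewrite !pairingD pairingN; congr (_ + _ - _).
  by rewrite pmulrn pair_mulrz /pairing /= -pmulrn; ring.
by ring.
Qed.

End CharExp.

(** * Jets *)

Section JetTrunc.
Variable K : numFieldType.
Implicit Types (P : {poly cseries2 K}) (r : K).

Lemma coef_npolyp_le m p (x : {poly_(m.+1) K}) :
  eq_upto p.+1 (npolyp p.+1 x : {poly K}) (x : {poly K}).
Proof. by move=> i ip; rewrite coef_npolyp ip. Qed.

Lemma comp_partial_trunc P m p (c : jet K m) N :
  eq_upto p.+1 (comp_partial P (jet_trunc p c) N) (comp_partial P c N).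
Proof.
apply: eq_upto_sum => i; apply: eq_upto_sum => k; apply: eq_upto_sum => l.
apply: eq_uptoZ; apply: eq_uptoM; [apply: eq_uptoM|];
  by apply: eq_uptoX; exact: coef_npolyp_le.
Qed.

Lemma t_order_trunc m p (x : {poly_(m.+1) K}) k : (k <= p)%N ->
  t_order (npolyp p.+1 x : {poly K}) k <-> t_order (x : {poly K}) k.
Proof.
move=> kp; have coefE i : (i <= k)%N -> (npolyp p.+1 x)`_i = x`_i.
  by move=> ik; rewrite coef_npolyp ltnS (leq_trans ik).
split=> -[xk xlt]; (split; [by rewrite ?coefE// -?coefE|]) => i ik.
  by rewrite -coefE ?xlt// ltnW.
by rewrite coefE ?xlt// ltnW.
Qed.

Lemma jet_D_trunc r P m p (nu : nat * nat) (c : jet K m) :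
  (nu.1 <= p)%N -> (nu.2 <= p)%N ->
  jet_D r P nu (jet_trunc p c) <->
  [/\ centered r c, forall s, (s <= p)%N ->
        (fun N => (comp_partial P c N)`_s) @ \oo --> (0 : K),
      t_order (jx1 c) nu.1 & t_order (jx2 c) nu.2].
Proof.
move=> nu1 nu2.
have vanE : jet_vanish P (jet_trunc p c) <-> (forall s, (s <= p)%N ->
    (fun N => (comp_partial P c N)`_s) @ \oo --> (0 : K)).
  have E s : (s <= p)%N -> (fun N => (comp_partial P (jet_trunc p c) N)`_s) =
      (fun N => (comp_partial P c N)`_s).
    by move=> sp; apply/funext => N; exact: comp_partial_trunc.
  by split=> van s sp; have := van s sp; rewrite E.
have cenE : centered r (jet_trunc p c) <-> centered r c.
  by rewrite /centered /= !coef_npolyp.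
have o1 := t_order_trunc (jx1 c) nu1; have o2 := t_order_trunc (jx2 c) nu2.
split=> [[[/cenE cen /vanE van] /o1 h1 /o2 h2]|[/cenE cen /vanE van /o1 h1 /o2 h2]].
  by split.
by split.
Qed.

Lemma jet_preimage_eq r P Q m p (nu : nat * nat) :
  (p <= m)%N -> (nu.1 <= p)%N -> (nu.2 <= p)%N ->
  (forall c : jet K m, centered r c ->
    t_order (jx1 c) nu.1 -> t_order (jx2 c) nu.2 ->
    jet_vanish P c <-> forall s, (s <= p)%N ->
      (fun N => (comp_partial Q c N)`_s) @ \oo --> (0 : K)) ->
  jet_D r P nu = jet_trunc p @^-1` jet_D r Q nu :> set (jet K m).
Proof.
move=> pm nu1 nu2 vanE; apply/seteqP; split=> c /=.
  move=> [[cen van] o1 o2]; apply/jet_D_trunc => //; split=> //.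
  exact: (vanE c cen o1 o2).1.
move=> /jet_D_trunc-/(_ nu1 nu2)[cen van o1 o2]; split=> //; split=> //.
exact: (vanE c cen o1 o2).2.
Qed.

End JetTrunc.

(** * Comparison of f with its approximated roots *)

Section Main.
Variables (K : numClosedFieldType) (Kcomplete : geom_complete K).
Variables (n' g : nat) (lam : nat -> rat * rat) (zeta : cseries2 K).
Variables (f : {poly cseries2 K}) (F : nat -> {poly cseries2 K}).
Local Notation n := n'.+1.
Hypothesis f_irr : irreducible_elt f.
Hypothesis f_monic : f \is monic.
Hypothesis f_size : size f = n.+1.
Hypothesis zeta_root : frac_root n f zeta.
Hypothesis lamP : char_exponents n zeta g lam.
Hypothesis F_approx : forall j, (0 < j <= g)%N ->
  min_poly n (trunc_root n zeta g lam j) (F j).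
Local Notation G := ('I_n * 'I_n)%type.
Local Notation zeta_ j := (trunc_root n zeta g lam j).

Lemma trunc_root_last : zeta_ g = zeta.
Proof. by apply: val_inj; apply: series2P => i j; rewrite /= ltnn. Qed.

Lemma approx_last : F g = f.
Proof.
have /F_approx minF : (0 < g <= g)%N by rewrite leqnn (char_gt0 lamP).
by rewrite (irreducible_min_poly f_irr f_monic _ minF)// trunc_root_last.
Qed.

Section Jet.
Variables (w : K) (w_prim : n.-primitive_root w).

(** zeta has n conjugates because its orbit polynomial is f; the stabilizer then has order n^2 / n.
    With |H_0| = n^2 this amounts to n = n_1 ... n_g. *)
Lemma card_dual_last : #|dual_class n' lam g| = n.
Proof.
have gg : (0 < g <= g)%N by rewrite leqnn (char_gt0 lamP).
have /F_approx minF := gg.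
have := card_orbit_stab w_prim (zeta_ g); rewrite (stab_trunc_root w_prim lamP gg).
have -> : size (conj_orbit w_prim (zeta_ g)) = n.
  apply/succn_inj; rewrite -size_orbit_poly -(min_poly_orbit w_prim minF).
  by rewrite (size_map_inj_poly (@ramify_inj K n') (rmorph0 _)) approx_last.
by move/eqP; rewrite eqn_pmul2l// => /eqP.
Qed.

Variables (rho tau : K) (y1 y2 : {poly K}).
Hypotheses (rho0 : 0 < rho) (tau0 : 0 < tau) (zeta_sum : summable2 rho (val zeta)).
Hypotheses (y1rho : norm1 tau y1 <= rho / 2) (y2rho : norm1 tau y2 <= rho / 2).

Lemma summable_trunc_root j : summable2 rho (val (zeta_ j)).
Proof.
apply: (summable2_le rho0) zeta_sum => a b /=.
by case: ifP => // _; rewrite normr0.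
Qed.

Lemma summable_conj e a : summable2 rho (val a) ->
  summable2 rho (val (conj_act w_prim e a)).
Proof.
apply: (summable2_le rho0) => i j.
by rewrite -[leRHS](norm_twist w_prim (e.1 : nat, e.2 : nat) a).
Qed.

Variables (m : nat) (c : jet K m) (nu : nat * nat).
Hypotheses (y1x : eq_upto (n * m).+1 (y1 ^+ n) ((jx1 c : {poly K}) \Po 'X^n)).
Hypotheses (y2x : eq_upto (n * m).+1 (y2 ^+ n) ((jx2 c : {poly K}) \Po 'X^n)).
Hypotheses (y1nu : 'X^(nu.1) %| y1) (y2nu : 'X^(nu.2) %| y2).

Local Notation ev := (eval_poly y1 y2 ((jz c : {poly K}) \Po 'X^n)).

(** The coefficients of index s n are the limits in question, and those of index prime to
    divisibility by n vanish up to order n m. *)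
Lemma vanish_order P q : (q <= m)%N -> summable_poly rho (map_poly (ramify n) P) ->
  (forall s, (s <= q)%N -> (fun N => (comp_partial P c N)`_s) @ \oo --> (0 : K)) <->
  vge (ev (map_poly (ramify n) P)) (n * q).+1.
Proof.
move=> qm gP.
have lim s : (s <= q)%N -> geom_lim (fun N => (comp_partial P c N)`_s)
    (coef2 (ev (map_poly (ramify n) P)) (s * n) 0).
  move=> sq; have sL : (s * n < (n * m).+1)%N.
    by rewrite ltnS mulnC leq_mul2l (leq_trans sq) ?orbT.
  have := ramified_eval_coef Kcomplete (ltn0Sn n') (jz c) y1x y2x rho0 tau0
    y1rho y2rho gP sL.
  by apply: geom_lim_ext => N; rewrite base_evalE.
split=> [van i iq|vP s sq].
  have [/dvdnP[s si]|ni] := boolP (n %| i)%N; last first.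
    apply: (ramified_eval_ndvd Kcomplete (ltn0Sn n') _ y1x y2x rho0 tau0 y1rho
      y2rho gP) => //.
    by rewrite (leq_trans iq)// ltnS leq_mul2l qm orbT.
  have sq : (s <= q)%N by move: iq; rewrite si ltnS mulnC leq_pmul2l.
  rewrite si; apply: (cvg_unique (@norm_hausdorff _ _) _ (van s sq)).
  exact: (geom_lim_cvg Kcomplete (lim s sq)).
have z0 : coef2 (ev (map_poly (ramify n) P)) (s * n) 0 = 0.
  by apply: vP; rewrite ltnS mulnC leq_mul2l sq orbT.
by have := geom_lim_cvg Kcomplete (lim s sq); rewrite z0.
Qed.

Let ev_sum := @summable_XsubC K rho rho0.

Lemma summable_ramify a P : summable2 rho (val a) -> min_poly n a P ->
  summable_poly rho (map_poly (ramify n) P).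
Proof.
move=> ga /(min_poly_orbit w_prim) ->.
rewrite /orbit_poly big_seq; elim/big_ind: _.
- exact: summable_poly1.
- by move=> S T; exact: summable_polyM.
- by move=> r /mem_conj_orbit[e ->]; apply: ev_sum; exact: summable_conj.
Qed.

Lemma eval_prod_conj a P : summable2 rho (val a) -> min_poly n a P ->
  \prod_(e : G) ev ('X - (conj_act w_prim e a)%:P) =
  ev (map_poly (ramify n) P) ^+ #|stab w_prim a|.
Proof.
move=> ga minP; rewrite -(eval_prod Kcomplete _ rho0 tau0 y1rho y2rho); last first.
  by move=> e; apply: ev_sum; exact: summable_conj.
rewrite prod_conj -(min_poly_orbit w_prim minP).
by rewrite (eval_exp Kcomplete _ rho0 tau0 y1rho y2rho)//;
  exact: summable_ramify minP.
Qed.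

Lemma eval_root_diff a b e e' v1 v2 : summable2 rho (val a) -> summable2 rho
  (val b) ->
  (forall i j, coef2 (conj_act w_prim e a - conj_act w_prim e' b) i j != 0 ->
     (v1 <= i)%N /\ (v2 <= j)%N) ->
  vge (ev ('X - (conj_act w_prim e' b)%:P) - ev ('X - (conj_act w_prim e a)%:P))
    (nu.1 * v1 + nu.2 * v2).
Proof.
move=> ga gb supp; have gea := summable_conj e ga; have geb := summable_conj e' gb.
rewrite !(eval_XsubC Kcomplete _ rho0 tau0 y1rho y2rho)//.
rewrite opprB addrA addrAC [poly_series _ - _]addrC addrK addrC.
rewrite -(subst_seriesN Kcomplete rho0 tau0 y1rho y2rho)//.
rewrite -(subst_seriesD Kcomplete rho0 tau0 y1rho y2rho)//; last exact: summable2N.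
apply: (vge_subst Kcomplete rho0 tau0 y1rho y2rho) => //.
by apply: summable2D => //; exact: summable2N.
Qed.

Lemma vanish_iff j : (0 < j < g)%N ->
  m%:R < (prod_idx lam j.+1 g)%:R * pairing nu (gamma_exp lam j.+1) ->
  jet_vanish f c <-> forall s, (s <= m %/ prod_idx lam j.+1 g)%N ->
    (fun N => (comp_partial (F j) c N)`_s) @ \oo --> (0 : K).
Proof.
move=> /andP[j0 jg] mlt; have jg' := ltnW jg.
have jP : (0 < j <= g)%N by rewrite j0.
have gP : (0 < g <= g)%N by rewrite leqnn (leq_trans j0).
set e := prod_idx lam j.+1 g in mlt *; pose p := (m %/ e)%N.
have [ab abP] := char_frac lamP.
have Hj : #|dual_class n' lam j| = (n * e)%N.
  by rewrite (card_dual w_prim lamP jg') card_dual_last.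
have e0 : (0 < e)%N.
  have : (0 < #|dual_class n' lam j|)%N.
    apply/card_gt0P; exists 0; apply/dual_classP => v _.
    by rewrite /pairing !mul0r addr0 rpred0.
  by rewrite Hj muln_gt0.
have pm : (p <= m)%N by exact: leq_div.
have gF := summable_ramify (summable_trunc_root j) (F_approx jP).
have minf : min_poly n zeta f by rewrite -trunc_root_last -approx_last;
  exact: F_approx.
have gf := summable_ramify zeta_sum minf.
rewrite (vanish_order pm gF) [X in X <-> _](vanish_order (leqnn m) gf).
have FA := eval_prod_conj (summable_trunc_root j) (F_approx jP).
rewrite (stab_trunc_root w_prim lamP jP) Hj in FA.
have GB := eval_prod_conj zeta_sum minf.
have stabf : #|stab w_prim zeta| = n.
  by rewrite -trunc_root_last (stab_trunc_root w_prim lamP gP) card_dual_last.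
rewrite stabf in GB.
have AB d : vge (ev ('X - (conj_act w_prim d zeta)%:P) -
    ev ('X - (conj_act w_prim d (zeta_ j))%:P)) (char_order ab nu j.+1).
  apply: eval_root_diff => //; first exact: summable_trunc_root.
  by move=> a b /(trunc_diff_supp abP); apply.
(* For d - d0 in H_k, the factor of d differs from that of d0 by a series of order at least
   [W k.+1], and the factor of d0 has order at least [W j.+1], which is no smaller. *)
have Aw d0 : vge (ev ('X - (conj_act w_prim d0 (zeta_ j))%:P)) (char_order ab
  nu j.+1) ->
    forall d, vge (ev ('X - (conj_act w_prim d (zeta_ j))%:P))
                (contact_order lam ab nu j d0 d).
  move=> Ad0 d; apply: (vge_contact_order lamP abP jg) => // k kj dk.
  set A0 := ev ('X - (conj_act w_prim d0 (zeta_ j))%:P) in Ad0.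
  rewrite -[ev _](subrK A0) -opprB; apply: vgeD; last first.
    by apply: vge_le Ad0; apply: (char_order_mono lamP nu abP).
  apply: vgeN; apply: eval_root_diff; try exact: summable_trunc_root.
  by move=> a b; exact: (conj_diff_supp lamP abP).
have [||[vG vF]|[k [vF vG]]] := compare_orders (m := m) (ltn0Sn n') e0 FA GB AB Aw.
- by move=> d0 d; exact: (contact_order_le lamP nu abP).
- move=> d0; rewrite -(ltr_nat rat) (sum_contact_order w_prim lamP nu abP)//;
  last first.
    exact: card_dual_last.
  by rewrite -mulnA !natrM !ltr_pM2l// ltr0n.
- split=> _ //; apply: vF.
  by rewrite mulnCA leq_mul2l mulnC leq_trunc_div orbT.
(* Here F_j has s-order k and f has e k, so the claim is that e k > n m iff k > n [m/e]. *)
split=> [/(vexact_vge _ vG) nmk|/(vexact_vge _ vF) npk].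
  apply/(vexact_vge _ vF); rewrite ltnNge; apply/negP => knp; move: nmk;
    rewrite ltnNge => /negP; apply.
  rewrite (leq_trans (leq_mul (leqnn e) knp))// mulnCA leq_mul2l mulnC.
  by rewrite leq_trunc_div orbT.
apply/(vexact_vge _ vG); have [nmk|knm] := ltnP (n * m) k;
  first by rewrite (leq_trans nmk)// leq_pmull.
(* Only now does k have to be a multiple of n: for k = k' n, k' > [m/e] gives e k' > m, whereas k >
   n [m/e] alone would not give e k > n m. *)
have [/dvdnP[k' kE]|ni] := boolP (n %| k)%N; last first.
  case: vF => _ /negP[]; apply/eqP.
  exact: (ramified_eval_ndvd Kcomplete (ltn0Sn n') _ y1x y2x rho0 tau0 y1rho
    y2rho gF).
rewrite kE mulnA [(e * _ * _)%N]mulnC ltn_pmul2l// mulnC -ltn_divLR//.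
by move: npk; rewrite kE mulnC ltn_pmul2r.
Qed.

End Jet.

Lemma jet_D_approximate_root : exists2 r0 : K, 0 < r0 &
  forall r : K, 0 < r -> r <= r0 ->
  forall (m : nat) (nu : nat * nat) (j : nat), (0 < j <= g)%N ->
    ((j < g)%N ->
       m%:R < (prod_idx lam j.+1 g)%:R * pairing nu (gamma_exp lam j.+1)) ->
    let p := (m %/ prod_idx lam j.+1 g)%N in
    (nu.1 <= p)%N -> (nu.2 <= p)%N ->
    jet_D r f nu = jet_trunc p @^-1` jet_D r (F j) nu :> set (jet K m).
Proof.
have [w w_prim] : exists w : K, n.-primitive_root w.
  by apply: prim_root_exists; rewrite pnatr_eq0.
have [rho rho0 zeta_sum] := convergent2_summable (cseries2_convergent zeta).
(* As y_k(0)^n = x_k(0), this bound on the center gives |y_k(0)| <= rho / 4, as [norm1_small]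
   requires. *)
exists ((rho / 4) ^+ n); first by rewrite exprn_gt0// divr_gt0.
move=> r r0 rle m nu j jP mlt p nu1 nu2.
apply: jet_preimage_eq => //; first exact: leq_div.
move=> c [c1 c2 _] o1 o2; rewrite /p.
(* For j = g the empty product gives e_g = 1, and F_g is f itself. *)
have /andP[j0] := jP; rewrite leq_eqVlt => /orP[/eqP ->|jg].
  by rewrite /prod_idx big_geq// divn1 approx_last.
have [y1 [y1x y1nu y10]] := nth_root_order (n * m) (ltn0Sn n') o1.
have [y2 [y2x y2nu y20]] := nth_root_order (n * m) (ltn0Sn n') o2.
have small (y x : K) : y ^+ n = x -> `|x| < r -> `|y| <= rho / 4.
  move=> yx xr; have q0 : 0 <= rho / 4 by rewrite divr_ge0// ltW.
  rewrite -(@ler_pXn2r _ n) ?nnegrE//.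
  by rewrite -normrX yx; apply: ltW; exact: lt_le_trans rle.
have [tau [tau0 y1rho y2rho]] := norm1_small rho0 (small _ _ y10 c1) (small _ _
  y20 c2).
apply: (vanish_iff w_prim rho0 tau0 zeta_sum y1rho y2rho y1x y2x y1nu y2nu) => //.
  by rewrite j0.
exact: mlt jg.
Qed.

End Main.

Theorem proposition1p2 (R : realType)
  (f : {poly cseries2 R[i]}) (zeta : cseries2 R[i])
  (g : nat) (lam : nat -> rat * rat) (F : nat -> {poly cseries2 R[i]})
  (f_irr : irreducible_elt f) (f_weierstrass : weierstrass f)
  (f_qo : quasi_ordinary f)
  (zeta_root : frac_root (size f).-1 f zeta)
  (lam_char : char_exponents (size f).-1 zeta g lam)
  (lam_norm : normalized_exponents (size f).-1 zeta g lam)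
  (F_approx : forall j, (0 < j <= g)%N ->
     min_poly (size f).-1 (trunc_root (size f).-1 zeta g lam j) (F j)) :
  exists2 r0 : R[i], 0 < r0 &
  forall r : R[i], 0 < r -> r <= r0 ->
  forall (m : nat) (nu : nat * nat) (j : nat),
    (0 < m)%N ->
    (0 < j <= g)%N ->
    sigma_latN lam j nu ->
    (prod_idx lam 1 g)%:R * pairing nu (gamma_exp lam 1) <= m%:R ->
    (prod_idx lam j g)%:R * pairing nu (gamma_exp lam j) <= m%:R ->
    ((j < g)%N ->
       m%:R < (prod_idx lam j.+1 g)%:R * pairing nu (gamma_exp lam j.+1)) ->
    let p := (m %/ prod_idx lam j.+1 g)%N in
    (nu.1 <= p)%N -> (nu.2 <= p)%N ->
    jet_D r f nu = jet_trunc p @^-1` jet_D r (F j) nu :> set (jet R[i] m).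
Proof.
have [f_monic _] := f_weierstrass.
(* A monic polynomial of degree 0 is 1, a unit; hence n is positive and of the form [n'.+1]. *)
have [n' f_size] : exists n', size f = n'.+2.
  have f0 : (0 < size f)%N by rewrite size_poly_gt0 monic_neq0.
  have [s1|] := eqVneq (size f) 1%N.
    have f1 := monic_size1 f_monic s1.
    by case: f_irr => _ []; exists 1; rewrite mulr1.
  by move: f0; case: (size f) => [|[|k]] // _ _; exists k.
rewrite f_size /= in zeta_root lam_char F_approx.
have [r0 r0_gt0 r0P] := jet_D_approximate_root (complex_geom_complete R)
  f_irr f_monic f_size zeta_root lam_char F_approx.
exists r0 => // r r_gt0 rle m nu j _ jg _ _ _ mlt.
exact: r0P.
Qed.
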